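(* Consider the simple random walk $\{E_t\}$ on growing $\mathbb{D}_t\subseteq\mathbb{Z}^2$ that starts from $E_0=0\in\mathbb{D}_0$ and opens only the three right/up/down edges adjacent to each site that it first visits (where after each such opening the walk stays put for one step before choosing its next position, now on $\mathbb{D}_{t+1}$). (a) If $\mathbb{D}_0$ consists of the vertices of $\mathbb{Z}^2$ with each edge of $\mathbb{Z}^2$ independently chosen to be in $\mathbb{D}_0$ with the same probability $p\in[0,1)$, then the sample path of $\{E_t\}$ is $\mathbb{P}_p$-a.s. transient. (b) Alternatively, the sample path of $\{E_t\}$ is a.s. transient whenever $k^{-r}\,|\mathbb{D}_0\cap[-k,k]^2|\to0$ as $k\to\infty$, for some constant $r<3/4$.
   Context: Precise dynamics: at the time $t$ of the first visit of the walk to a site $x=E_t$ (time $0$ being the first visit to $0$), the three edges of $\mathbb{Z}^2$ from $x$ to $x+(1,0)$, $x+(0,1)$ and $x+(0,-1)$ (and their endpoints) are added, so $\mathbb{D}_{t+1}$ is $\mathbb{D}_t$ together with these edges, and $E_{t+1}=E_t$. At all other times $t$, $\mathbb{D}_{t+1}=\mathbb{D}_t$ and, given the past, $E_{t+1}$ is chosen uniformly among the neighbors of $E_t$ in $\mathbb{D}_t$. The edge to the left of $x$ is thus available only if it is in $\mathbb{D}_0$ or the site $x-(1,0)$ has already been visited. $\mathbb{P}_p$ denotes the joint law of the random $\mathbb{D}_0$ in (a) and of the walk. In (b), $\mathbb{D}_0$ is a given subgraph of $\mathbb{Z}^2$ containing $0$, and $|\mathbb{D}_0\cap[-k,k]^2|$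 is the number of sites of $\mathbb{D}_0$ in $[-k,k]^2$. The sample path is transient if $E_t=0$ for only finitely many $t$. *)

(* Defs.v *)
From HB Require Import structures.
From mathcomp Require Import all_boot all_order all_algebra finmap.
From mathcomp Require Import all_classical all_reals all_analysis.
Set Implicit Arguments.
Unset Strict Implicit.
Unset Printing Implicit Defensive.
Import Order.TTheory GRing.Theory Num.Theory.
Import numFieldNormedType.Exports.
Local Open Scope classical_set_scope.
Local Open Scope ring_scope.

Notation site := (int * int)%type.

Definition e1 : site := (1, 0).
Definition e2 : site := (0, 1).

(* Each undirected edge of Z^2 has exactly one code: (x, false) is the edge
   from x to x + e1, and (x, true) is the edge from x to x + e2. *)
Notation edge := (site * bool)%type.

Definition src (a : edge) : site := a.1.
Definition tgt (a : edge) : site := a.1 + (if a.2 then e2 else e1).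

Record subgraph := Subgraph {
  verts : set site;
  edges : set edge;
  edges_verts : forall a, edges a -> verts (src a) /\ verts (tgt a)
}.

Definition adj (G : subgraph) (x y : site) : Prop :=
  exists2 a, edges G a &
    (x = src a /\ y = tgt a) \/ (x = tgt a /\ y = src a).

Definition nbrs (G : subgraph) (x : site) : set site := [set y | adj G x y].

Lemma open_at_subproof (G : subgraph) (x : site) (a : edge) :
  (edges G `|` [set (x, false); (x, true); (x - e2, true)]) a ->
  let V := verts G `|` [set x; x + e1; x + e2; x - e2] in
  V (src a) /\ V (tgt a).
Proof.
case=> [/edges_verts[? ?]|[[->|->]|->]]; rewrite /src /tgt /=.
- by split; left.
- by split; right; left; left; [left|right].
- by split; right; left; [left; left|right].
- by rewrite subrK; split; right; [right|left; left; left].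
Qed.

(* The edge (x - e2, true) joins x to x + (0,-1). *)
Definition open_at (G : subgraph) (x : site) : subgraph :=
  @Subgraph (verts G `|` [set x; x + e1; x + e2; x - e2])
    (edges G `|` [set (x, false); (x, true); (x - e2, true)])
    (open_at_subproof (G := G) (x := x)).

Definition first_visit (e : nat -> site) (t : nat) : bool :=
  e t \notin mkseq e t.

Fixpoint growing (G0 : subgraph) (e : nat -> site) (t : nat) : subgraph :=
  if t is s.+1 then
    if first_visit e s then open_at (growing G0 e s) (e s)
    else growing G0 e s
  else G0.

(* Conditional probability that the position at time t + 1 is y, given the
   initial graph G0 and the positions e 0, ..., e t (later values of e are
   not used). *)
Definition step_prob (R : realType) (G0 : subgraph) (e : nat -> site)
    (t : nat) (y : site) : R :=
  let G := growing G0 e t in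
  if first_visit e t then (y == e t)%:R
  else if `[< adj G (e t) y >] then (#|` fset_set (nbrs G (e t))|%:R)^-1
  else 0.

(* Generators of the sigma-algebra of D0 and E 0, ..., E t. *)
Definition past (T : Type) (D0 : T -> subgraph) (E : nat -> T -> site)
    (t : nat) : set (set T) :=
  [set B | exists x, B = [set w | verts (D0 w) x]] `|`
  [set B | exists a, B = [set w | edges (D0 w) a]] `|`
  [set B | exists s x, (s <= t)%N /\ B = [set w | E s w = x]].

(* The field walk_step says that step_prob is the conditional law of
   E (t + 1) given the sigma-algebra of D0 and E 0, ..., E t. *)
Record growing_walk (d : measure_display) (T : measurableType d)
    (R : realType) (P : probability T R)
    (D0 : T -> subgraph) (E : nat -> T -> site) : Prop := GrowingWalk {
  measurable_verts : forall x, measurable [set w | verts (D0 w) x];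
  measurable_edges : forall a, measurable [set w | edges (D0 w) a];
  measurable_walk : forall t x, measurable [set w | E t w = x];
  walk_start : P [set w | E 0%N w = 0] = 1%E;
  walk_step : forall t y (A : set T), <<s past D0 E t >> A ->
    P (A `&` [set w | E t.+1 w = y]) =
    (\int[P]_(w in A) (step_prob R (D0 w) (E^~ w) t y)%:E)%E
}.

Definition mutually_independent (d : measure_display) (T : measurableType d)
    (R : realType) (P : probability T R) (I : choiceType)
    (A : I -> set T) : Prop :=
  forall F : {fset I},
    P (\bigcap_(i in [set` F]) A i) = (\prod_(i <- F) P (A i))%E.

Record percolation (d : measure_display) (T : measurableType d)
    (R : realType) (P : probability T R) (p : R)
    (D0 : T -> subgraph) : Prop := Percolation {
  percolation_verts : forall w, verts (D0 w) = setT;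
  percolation_edges : forall a, P [set w | edges (D0 w) a] = p%:E;
  percolation_indep :
    mutually_independent P (fun a : edge => [set w | edges (D0 w) a])
}.

Definition box (k : nat) : set site :=
  [set x | `|x.1| <= k%:Z /\ `|x.2| <= k%:Z].

Definition sites_in_box (G : subgraph) (k : nat) : nat :=
  #|` fset_set (verts G `&` box k)|.

Definition transient (e : nat -> site) : Prop :=
  finite_set [set t | e t = 0].

(* Main.v *)
Require Import Defs.
From HB Require Import structures.
From mathcomp Require Import all_boot all_order all_algebra finmap.
From mathcomp Require Import all_classical all_reals all_analysis.
From mathcomp Require Import zify ring lra.
Set Implicit Arguments.
Unset Strict Implicit.
Unset Printing Implicit Defensive.
Import Order.TTheory GRing.Theory Num.Theory.
Import numFieldNormedType.Exports.
Local Open Scope classical_set_scope.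
Local Open Scope ring_scope.

(* Follow i.i.d. uniform directions in {right, up, left, down}, ignoring a left
   step along an edge which is not available: up to stalls and pauses this is
   the walk E, and its position is S + (o, 0), where S is the simple random walk
   of the directions and o is the number of stalls so far. Since o is
   nondecreasing, when S jumps at least 2 beyond its past on a row, the left
   neighbor of the position of E has not been visited; if moreover the next
   direction is left and the initial graph lacks the left edge, the walk stalls.

   The number of such good steps made by time n is at least n^(3/4 - eps) with
   probability close to 1. On one row this is a renewal process, and cutting a
   path at its rightmost visit to the row, together with time reversal, bounds
   the truncated mean waiting time for a good step by C n^(3/4); so each of the
   n^(1/2 - eps) lowest rows has n^(1/4 - eps) good steps with high probability.

   Given o, the good steps use distinct left edges. In (b) at most n^r of them
   are in the initial graph; in (a) all but o of them would have to be open, and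
   a union bound over the possible stall times makes this unlikely unless
   o > n^(1/2 + eps). Hence S + (o, 0) stays to the right of 0 over dyadic
   scales, and Borel-Cantelli concludes. *)

(** * Words and the uniform average *)

Variant dir := Rt | Up | Lt | Dn.

Definition is_left (a : dir) : bool := if a is Lt then true else false.

Definition dvec (a : dir) : int * int :=
  match a with Rt => (1, 0) | Up => (0, 1) | Lt => (-1, 0) | Dn => (0, -1) end.

Definition pos (w : seq dir) : int * int := \sum_(a <- w) dvec a.

Lemma pos_nil : pos [::] = 0.
Proof. by rewrite /pos big_nil. Qed.

Lemma pos_cons a w : pos (a :: w) = dvec a + pos w.
Proof. by rewrite /pos big_cons. Qed.

Lemma pos_cat u v : pos (u ++ v) = pos u + pos v.
Proof. by rewrite /pos big_cat. Qed.

Lemma pos_rcons w a : pos (rcons w a) = pos w + dvec a.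
Proof. by rewrite -cats1 pos_cat pos_cons pos_nil addr0. Qed.

Lemma pos_rev w : pos (rev w) = pos w.
Proof. by elim: w => // a w IH; rewrite rev_cons pos_rcons pos_cons IH addrC. Qed.

Section Average.
Variable R : realFieldType.
Implicit Types (f g : seq dir -> R) (n : nat) (c x y : R).

(* The expectation of [f] under the uniform law on words of length [n]. *)
Fixpoint avg n f : R :=
  if n is n'.+1 then
    (avg n' (fun w => f (Rt :: w)) + avg n' (fun w => f (Up :: w)) +
     avg n' (fun w => f (Lt :: w)) + avg n' (fun w => f (Dn :: w))) / 4
  else f [::].

Lemma avgS n f : avg n.+1 f =
  (avg n (fun w => f (Rt :: w)) + avg n (fun w => f (Up :: w)) +
   avg n (fun w => f (Lt :: w)) + avg n (fun w => f (Dn :: w))) / 4.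
Proof. by []. Qed.

Lemma avg_le n f g : (forall w, size w = n -> f w <= g w) -> avg n f <= avg n g.
Proof.
elim: n f g => [|n IH] f g le_fg /=; first exact: le_fg.
have H a : avg n (fun w => f (a :: w)) <= avg n (fun w => g (a :: w)).
  by apply: IH => w sw; apply: le_fg; rewrite /= sw.
by have := H Rt; have := H Up; have := H Lt; have := H Dn; lra.
Qed.

Lemma eq_avg n f g : (forall w, size w = n -> f w = g w) -> avg n f = avg n g.
Proof.
by move=> e; apply/eqP; rewrite eq_le !avg_le // => w /e ->.
Qed.

Lemma avgD n f g : avg n (fun w => f w + g w) = avg n f + avg n g.
Proof. by elim: n f g => //= n IH f g; rewrite !IH; lra. Qed.

Lemma avgZ n c f : avg n (fun w => c * f w) = c * avg n f.
Proof. by elim: n f => //= n IH f; rewrite !IH; lra. Qed.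

Lemma avgZr n c f : avg n (fun w => f w * c) = avg n f * c.
Proof. by elim: n f => //= n IH f; rewrite !IH; lra. Qed.

Lemma avg_cst n c : avg n (fun=> c) = c.
Proof. by elim: n => //= n ->; lra. Qed.

Lemma avg_ge0 n f : (forall w, size w = n -> 0 <= f w) -> 0 <= avg n f.
Proof. by move=> f0; rewrite -(avg_cst n 0) avg_le. Qed.

Lemma avg_sum n (I : Type) (r : seq I) (Q : pred I) (F : I -> seq dir -> R) :
  avg n (fun w => \sum_(i <- r | Q i) F i w) = \sum_(i <- r | Q i) avg n (F i).
Proof.
elim: r => [|i r IH].
  by rewrite big_nil (@eq_avg n _ (fun=> 0)) ?avg_cst// => w _; rewrite big_nil.
rewrite big_cons -IH; case: ifP => Qi.
  by rewrite -avgD; apply: eq_avg => w _; rewrite big_cons Qi.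
by apply: eq_avg => w _; rewrite big_cons Qi.
Qed.

Lemma avg_cat m n f : avg (m + n) f = avg m (fun u => avg n (fun v => f (u ++ v))).
Proof. by elim: m f => //= m IH f; rewrite !IH. Qed.

Lemma avg_split m n f g :
  avg (m + n) (fun w => f (take m w) * g (drop m w)) = avg m f * avg n g.
Proof.
rewrite avg_cat -avgZr; apply: eq_avg => u su; rewrite -avgZ.
by apply: eq_avg => v _; rewrite take_size_cat// drop_size_cat.
Qed.

Lemma avg_take m n f : avg (m + n) (fun w => f (take m w)) = avg m f.
Proof.
rewrite -[RHS]mulr1 -(avg_cst n 1) -avg_split.
by apply: eq_avg => w _; rewrite mulr1.
Qed.

Lemma avgS_rcons n f : avg n.+1 f =
  (avg n (fun w => f (rcons w Rt)) + avg n (fun w => f (rcons w Up)) +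
   avg n (fun w => f (rcons w Lt)) + avg n (fun w => f (rcons w Dn))) / 4.
Proof.
rewrite -addn1 avg_cat -!avgD -avgZr; apply: eq_avg => w _ /=.
by rewrite !cats1.
Qed.

Lemma avg_rev n f : avg n (fun w => f (rev w)) = avg n f.
Proof.
elim: n f => // n IH f.
rewrite avgS avgS_rcons.
have H a : avg n (fun w => f (rev (a :: w))) = avg n (fun w => f (rcons w a)).
  by rewrite -[RHS]IH; apply: eq_avg => w _; rewrite rev_cons.
by rewrite !H.
Qed.

Definition mirror (a : dir) : dir :=
  match a with Rt => Lt | Lt => Rt | b => b end.

Lemma avg_mirror n f : avg n (fun w => f (map mirror w)) = avg n f.
Proof.
elim: n f => // n IH f /=.
by rewrite !(IH (fun w => f (_ :: w))); lra.
Qed.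

Lemma avg_ge_word f u : (forall w, 0 <= f w) -> f u / 4 ^+ size u <= avg (size u) f.
Proof.
elim: u f => [|a u IH] f f0; first by rewrite /= expr0 divr1.
have H b : 0 <= avg (size u) (fun w => f (b :: w)) by exact: avg_ge0.
have := IH (fun w => f (a :: w)) (fun w => f0 (a :: w)); rewrite /= exprS invfM mulrCA.
by have := H Rt; have := H Up; have := H Lt; have := H Dn; case: a => /=; lra.
Qed.

Lemma avg_union_bound n (I : Type) (r : seq I) (Q : I -> seq dir -> bool)
  (q : seq dir -> bool) :
  (forall w, size w = n -> q w -> has (Q^~ w) r) ->
  avg n (fun w => (q w)%:R) <= \sum_(i <- r) avg n (fun w => (Q i w)%:R).
Proof.
move=> H; rewrite -avg_sum; apply: avg_le => w /H {}H.
case qw: (q w); last by rewrite sumr_ge0// => i _; rewrite ler0n.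
move: (H qw) => {H}; elim: r => //= i r IH.
rewrite big_cons; case: (Q i w) => /=; last by move/IH; rewrite add0r.
by move=> _; rewrite lerDl sumr_ge0// => j _; rewrite ler0n.
Qed.

End Average.

(** * Moments of the simple random walk *)

Definition X (w : seq dir) : int := (pos w).1.
Definition Y (w : seq dir) : int := (pos w).2.

Lemma X_nil : X [::] = 0. Proof. by rewrite /X pos_nil. Qed.
Lemma Y_nil : Y [::] = 0. Proof. by rewrite /Y pos_nil. Qed.
Lemma X_cons a w : X (a :: w) = (dvec a).1 + X w.
Proof. by rewrite /X pos_cons. Qed.
Lemma Y_cons a w : Y (a :: w) = (dvec a).2 + Y w.
Proof. by rewrite /Y pos_cons. Qed.
Lemma X_cat u v : X (u ++ v) = X u + X v.
Proof. by rewrite /X pos_cat. Qed.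
Lemma Y_cat u v : Y (u ++ v) = Y u + Y v.
Proof. by rewrite /Y pos_cat. Qed.
Lemma X_rcons w a : X (rcons w a) = X w + (dvec a).1.
Proof. by rewrite /X pos_rcons. Qed.
Lemma Y_rcons w a : Y (rcons w a) = Y w + (dvec a).2.
Proof. by rewrite /Y pos_rcons. Qed.

Fixpoint goes_below (H x : int) (w : seq dir) : bool :=
  (x <= - H) || (if w is a :: w' then goes_below H (x + (dvec a).1) w' else false).

Lemma goes_belowPn H x w i : ~~ goes_below H x w -> - H < x + X (take i w).
Proof.
elim: w x i => [|a w IH] x i /=; rewrite negb_or -ltNge.
  by rewrite X_nil addr0 => /andP[].
case: i => [|i] /andP[h1 h2]; first by rewrite X_nil addr0.
by rewrite X_cons addrA; exact: IH.
Qed.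

Section Moments.
Variable R : realFieldType.

(** Kolmogorov's maximal inequality, by induction on the first step: the right side is at least
    [H ^ 2] once [x <= - H], and otherwise it is preserved by one step, which adds 1/2 to the mean
    of [x ^ 2]. *)
Lemma avg_goes_below n (H x : int) : 0 < H ->
  avg n (fun w => (goes_below H x w)%:R) * H%:~R ^+ 2
    <= (x%:~R ^+ 2 + n%:R / 2 : R).
Proof.
move=> H0; have HR : 0 < (H%:~R : R) by rewrite ltr0z.
have small m (y : int) : avg m (fun w => (goes_below H y w)%:R) <= 1 :> R.
  by rewrite -[leRHS](avg_cst m 1); apply: avg_le => w _; rewrite lern1 leq_b1.
elim: n x => [|n IH] x.
  rewrite /= orbF; case: (boolP (x <= - H)) => h /=; last by rewrite !mul0r addr0 sqr_ge0.
  have : x%:~R <= - H%:~R :> R by rewrite -mulrNz ler_int.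
  by move=> ?; nra.
have [h|h] := boolP (x <= - H).
  have : x%:~R <= - H%:~R :> R by rewrite -mulrNz ler_int.
  have := small n.+1 x; have : 0 <= (n.+1)%:R :> R by rewrite ler0n.
  by set p := avg _ _; move=> *; nra.
have E a : avg n (fun w => (goes_below H x (a :: w))%:R) * H%:~R ^+ 2 <=
    (x + (dvec a).1)%:~R ^+ 2 + n%:R / 2 :> R.
  by rewrite /= (negbTE h); exact: IH.
rewrite avgS -[n.+1%:R]natr1.
have := E Rt; have := E Up; have := E Lt; have := E Dn.
rewrite /= addr0 !intrD mulrN1z.
lra.
Qed.

Definition unlefts (w : seq dir) : nat := count (predC is_left) w.

Lemma avg_unlefts_var n (x : R) :
  avg n (fun w => ((unlefts w)%:R + x - 3 / 4 * n%:R) ^+ 2) = x ^+ 2 + 3 / 16 * n%:R.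
Proof.
elim: n x => [|n IH] x; first by rewrite /=; lra.
have E a : avg n (fun w => ((unlefts (a :: w))%:R + x - 3 / 4 * n.+1%:R) ^+ 2) =
    ((~~ is_left a)%:R + x - 3 / 4) ^+ 2 + 3 / 16 * n%:R.
  rewrite -IH; apply: eq_avg => w _.
  by rewrite /unlefts /= natrD -[n.+1%:R]natr1; congr (_ ^+ 2); lra.
by rewrite avgS !E /= -[n.+1%:R]natr1; lra.
Qed.

(** Chebyshev's inequality: the mean is [3 / 4 * n], so the event is a deviation of at least
    [n / 4], while the variance is [3 / 16 * n]. *)
Lemma avg_few_unlefts n :
  n%:R * avg n (fun w => (2 * unlefts w < n)%N%:R) <= 3 :> R.
Proof.
case: n => [|n]; first by rewrite mul0r; lra.
have := avg_unlefts_var n.+1 0; set N := n.+1; move=> E.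
have N0 : 0 < N%:R :> R by rewrite ltr0n.
suff : (N%:R / 4) ^+ 2 * avg N (fun w => (2 * unlefts w < N)%N%:R) <= 3 / 16 * N%:R :> R.
  by move=> h; rewrite -(ler_pM2r N0); lra.
rewrite -avgZ.
have <- : (0 : R) ^+ 2 + 3 / 16 * N%:R = 3 / 16 * N%:R by lra.
rewrite -E; apply: avg_le => w _.
case: ltnP => h; last by rewrite mulr0 sqr_ge0.
have : 2 * (unlefts w)%:R <= N%:R :> R by rewrite -natrM ler_nat ltnW.
by move=> ?; rewrite mulr1; nra.
Qed.

Lemma avg_Y2 n : avg n (fun w => (Y w)%:~R ^+ 2) = n%:R / 2 :> R.
Proof.
elim: n => [|n IH]; first by rewrite /= Y_nil; lra.
rewrite avgS_rcons -!avgD -avgZr -[n.+1%:R]natr1 mulrDl -IH -[X in _ = _ + X](avg_cst n) -avgD.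
by apply: eq_avg => w _; rewrite !Y_rcons /= !addr0 !intrD mulrN1z; lra.
Qed.

Lemma avg_Y4 n : avg n (fun w => (Y w)%:~R ^+ 4) = 3 / 4 * n%:R ^+ 2 - n%:R / 4 :> R.
Proof.
elim: n => [|n IH]; first by rewrite /= Y_nil; lra.
have -> : 3 / 4 * n.+1%:R ^+ 2 - n.+1%:R / 4 =
   3 / 4 * n%:R ^+ 2 - n%:R / 4 + (3 * (n%:R / 2) + 1 / 2) :> R.
  by rewrite -[n.+1%:R]natr1; lra.
rewrite -IH -avg_Y2 -[1 / 2](avg_cst n) -avgZ -!avgD.
rewrite avgS_rcons -!avgD -avgZr.
by apply: eq_avg => w _; rewrite !Y_rcons /= !addr0 !intrD mulrN1z; lra.
Qed.

(** Discrete Tanaka formula: [|Y|] has zero mean increment away from 0, and grows by 1 with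
    probability 1/2 from 0. *)
Lemma avg_absY n : avg n (fun w => `|(Y w)%:~R|) =
  (\sum_(k < n) avg k (fun w => (Y w == 0)%:R)) / 2 :> R.
Proof.
elim: n => [|n IH]; first by rewrite /= Y_nil big_ord0 normr0 mul0r.
rewrite big_ord_recr mulrDl -IH avgS_rcons -!avgD -!avgZr -avgD.
apply: eq_avg => w _.
rewrite !Y_rcons /= !addr0 -!intr_norm.
suff /(congr1 (fun z : int => z%:~R : R)) :
    `|Y w + 1| + `|Y w - 1| = 2 * `|Y w| + 2 * (Y w == 0)%:Z.
  by rewrite !intrD !intrM -pmulrn => E; rewrite -addrA addrAC -!addrA; lra.
by case: eqP => [->|]; lia.
Qed.

(** By the Tanaka formula the sum is twice the mean of [|Y|] at time [s ^ 2], which the second and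
    fourth moments bound from below by a multiple of [s]. The truncation level is [2 * s], of the
    order of the typical size of [Y]. *)
Lemma sum_return_ge s :
  s%:R / 4 <= \sum_(k < s ^ 2) avg k (fun w => (Y w == 0)%:R) :> R.
Proof.
case: s => [|s]; first by rewrite mul0r sumr_ge0// => i _; rewrite avg_ge0.
set n := (s.+1 ^ 2)%N; set x : R := s.+1%:R.
have nx : n%:R = x ^+ 2 by rewrite natrX.
have x0 : 0 < x by rewrite ltr0n.
suff : x / 8 <= avg n (fun w => `|(Y w)%:~R|) by rewrite avg_absY; lra.
(* For [b > 0], [b^2 y^2 - y^4 <= b^3 |y|]: the moments bound [E |Y|] from below. *)
have /(_ n) : forall n,
    avg n (fun w => (2 * x) ^+ 2 * (Y w)%:~R ^+ 2 + (-1) * (Y w)%:~R ^+ 4)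
    <= avg n (fun w => (2 * x) ^+ 3 * `|(Y w)%:~R|) :> R.
  move=> m; apply: avg_le => w _; set y : R := (Y w)%:~R.
  have -> : y ^+ 2 = `|y| ^+ 2 by rewrite real_normK ?num_real.
  have -> : y ^+ 4 = `|y| ^+ 4 by rewrite -[in RHS]normrX ger0_norm ?exprn_even_ge0.
  have := normr_ge0 y; move: (`|y|) => a a0.
  have [h|h] := lerP a (2 * x).
    have : (2 * x) ^+ 2 * a ^+ 2 <= (2 * x) ^+ 3 * a.
      have : 0 <= a * x ^+ 2 * (2 * x - a) by rewrite !mulr_ge0 ?sqr_ge0// subr_ge0.
      by lra.
    have : 0 <= a ^+ 4 by rewrite exprn_ge0.
    by lra.
  have : 0 <= (2 * x) ^+ 3 * a by rewrite mulr_ge0// exprn_ge0//; lra.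
  have : a ^+ 2 * (2 * x) ^+ 2 <= a ^+ 2 * a ^+ 2.
    by rewrite ler_wpM2l ?exprn_ge0// lerXn2r ?nnegrE//; lra.
  by lra.
rewrite avgD !avgZ avg_Y2 avg_Y4 nx => h.
rewrite -(ler_pM2l (_ : 0 < (2 * x) ^+ 3)); last by rewrite exprn_gt0//; lra.
apply: le_trans h; have := exprn_gt0 2 x0; have := exprn_gt0 4 x0; lra.
Qed.

End Moments.

(** * Records of the walk on a row *)

Section Convolution.
Variable R : realFieldType.
Implicit Types a b : nat -> R.

Lemma sum_triangle (F : nat -> nat -> R) n :
  \sum_(k < n) \sum_(i < k.+1) F i (k - i)%N = \sum_(i < n) \sum_(j < n - i) F i j.
Proof.
elim: n => [|n IH]; first by rewrite !big_ord0.
rewrite big_ord_recr IH [RHS]big_ord_recr /= subSnn big_ord1.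
rewrite [X in _ + X]big_ord_recr /= subnn addrA; congr (_ + _).
rewrite -big_split /=; apply: eq_bigr => i _.
by rewrite subSn ?big_ord_recr// ltnW.
Qed.

Lemma ler_sum_widen a m n : (m <= n)%N -> (forall i, 0 <= a i) ->
  \sum_(i < m) a i <= \sum_(i < n) a i.
Proof.
move=> /subnK <- a0; elim: (n - m)%N => //= d; rewrite addSn big_ord_recr /= => h.
by apply: le_trans h _; rewrite lerDl.
Qed.

(** The triangle [i + j < n] lies in the square of side [n]. *)
Lemma convolution_le a b n : (forall i, 0 <= a i) -> (forall i, 0 <= b i) ->
  \sum_(k < n) \sum_(i < k.+1) a i * b (k - i)%N
    <= (\sum_(i < n) a i) * (\sum_(j < n) b j).
Proof.
move=> a0 b0; rewrite (sum_triangle (fun i j => a i * b j)) mulr_suml.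
apply: ler_sum => i _; rewrite -mulr_sumr ler_wpM2l// ler_sum_widen//.
exact: leq_subr.
Qed.

(** The square of side [n] lies in the triangle [i + j < n + n]. *)
Lemma convolution_ge a b n : (forall i, 0 <= a i) -> (forall i, 0 <= b i) ->
  (\sum_(i < n) a i) * (\sum_(j < n) b j)
    <= \sum_(k < n + n) \sum_(i < k.+1) a i * b (k - i)%N.
Proof.
move=> a0 b0; rewrite (sum_triangle (fun i j => a i * b j)) mulr_suml.
have ab0 i j : 0 <= a i * b j by exact: mulr_ge0.
apply: le_trans (@ler_sum_widen (fun i => \sum_(j < n + n - i) a i * b j) n _ _ _).
- apply: ler_sum => i _; rewrite -mulr_sumr ler_wpM2l// ler_sum_widen//.
  by have := ltn_ord i; lia.
- exact: leq_addr.
- by move=> i; rewrite sumr_ge0.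
Qed.

End Convolution.

Definition row_record (w : seq dir) : bool :=
  (Y w == 0) &&
  all (fun i => (Y (take i w) == 0) ==> (X (take i w) < X w)) (iota 0 (size w)).

Definition row_nonpos (w : seq dir) : bool :=
  (Y w == 0) &&
  all (fun i => (Y (take i w) == 0) ==> (X (take i w) <= 0)) (iota 0 (size w).+1).

Lemma row_recordP w : reflect (Y w = 0 /\
    forall i, (i < size w)%N -> Y (take i w) = 0 -> X (take i w) < X w) (row_record w).
Proof.
apply: (iffP andP) => -[/eqP Yw H]; split; rewrite ?Yw//.
  by move=> i iw Yi; move: H => /allP/(_ i); rewrite mem_iota /= add0n iw Yi eqxx => /(_ isT).
by apply/allP => i; rewrite mem_iota /= => iw; apply/implyP => /eqP; apply: H.
Qed.

Lemma row_nonposP w : reflect (Y w = 0 /\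
    forall i, (i <= size w)%N -> Y (take i w) = 0 -> X (take i w) <= 0) (row_nonpos w).
Proof.
apply: (iffP andP) => -[/eqP Yw H]; split; rewrite ?Yw//.
  by move=> i iw Yi; move: H => /allP/(_ i); rewrite mem_iota /= add0n ltnS iw Yi eqxx => /(_ isT).
by apply/allP => i; rewrite mem_iota /= => iw; apply/implyP => /eqP; apply: H.
Qed.

(* Cut at the first visit to the rightmost visited point of row 0. *)
Lemma row_decomposition w : Y w = 0 ->
  exists2 i, (i <= size w)%N & row_record (take i w) && row_nonpos (drop i w).
Proof.
move=> Yw; set n := size w.
pose Q i := [&& (i <= n)%N, Y (take i w) == 0 &
  all (fun j => (Y (take j w) == 0) ==> (X (take j w) <= X (take i w))) (iota 0 n.+1)].
have exQ : exists i, Q i.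
  pose i0 : 'I_n.+1 := ord_max.
  pose F (i : 'I_n.+1) := X (take i w).
  have P0 : Y (take i0 w) == 0 by rewrite take_size Yw.
  have [i Pi maxi] := @Order.TotalTheory.arg_maxP _ _ _ i0 (fun i => Y (take i w) == 0) F P0.
  exists i; rewrite /Q -ltnS ltn_ord Pi; apply/allP => j; rewrite mem_iota add0n => jn.
  by apply/implyP => Yj; have := maxi (Ordinal jn) Yj.
case: (ex_minnP exQ) => i /and3P[i_n /eqP Yi max0] mini.
have maxi j : (j <= n)%N -> Y (take j w) = 0 -> X (take j w) <= X (take i w).
  by move=> jn Yj; have := allP max0 j; rewrite mem_iota /= add0n ltnS jn Yj eqxx => /(_ isT).
exists i => //; apply/andP; split.
  apply/row_recordP; split=> // j; rewrite size_take_min => ji.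
  have {}ji : (j < i)%N by lia.
  have jn : (j <= n)%N by lia.
  rewrite take_takel ?(ltnW ji)// => Yj; rewrite lt_neqAle maxi// andbT.
  apply/negP => /eqP E; have := mini j; rewrite /Q jn Yj eqxx.
  rewrite leqNgt ji => F; suff : false by []; apply: F.
  apply/allP => k; rewrite mem_iota ltnS => /= kn; apply/implyP => /eqP Yk.
  by rewrite E maxi.
have Yd j : Y (take j (drop i w)) = Y (take (i + j) w) - Y (take i w).
  by rewrite takeD Y_cat addrC addKr.
have Xd j : X (take j (drop i w)) = X (take (i + j) w) - X (take i w).
  by rewrite takeD X_cat addrC addKr.
apply/row_nonposP; split.
  have := Yd (n - i)%N; rewrite -size_drop take_size => ->.
  by rewrite size_drop subnKC// take_size Yw Yi.
move=> j; rewrite size_drop Yd Xd Yi subr0 => jn Yj.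
by rewrite subr_le0 maxi//; lia.
Qed.

Lemma X_mirror w : X (map mirror w) = - X w.
Proof. by elim: w => [|a w IH]; rewrite ?X_nil//= !X_cons IH; case: a => /=; lia. Qed.

Lemma Y_mirror w : Y (map mirror w) = Y w.
Proof. by elim: w => [|a w IH] //=; rewrite !Y_cons IH; case: a. Qed.

(** The reversed and mirrored path visits the row at the points [X (take j w) - X w], and ends at
    [- X w]. Since [X (take j w) <= 0], none of them is to the right of the end, and the last right
    step makes the inequality strict. *)
Lemma row_record_rev w : row_nonpos w -> row_record (rcons (rev (map mirror w)) Rt).
Proof.
move=> /row_nonposP[Yw H]; apply/row_recordP.
have Yr v : Y (rev v) = Y v by rewrite /Y pos_rev.
have Xr v : X (rev v) = X v by rewrite /X pos_rev.
rewrite Y_rcons X_rcons Yr Xr X_mirror Y_mirror Yw /=; split=> // i.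
rewrite size_rcons size_rev size_map ltnS => iw.
rewrite -cats1 takel_cat ?size_rev ?size_map//.
rewrite take_rev Yr Xr size_map -map_drop Y_mirror X_mirror.
set j := (size w - i)%N; have jw : (j <= size w)%N by lia.
have [Ej Fj] : X w = X (take j w) + X (drop j w) /\ Y w = Y (take j w) + Y (drop j w).
  by rewrite -X_cat -Y_cat !cat_take_drop.
move=> Yd; have := H j jw; lia.
Qed.

Section Duality.
Variable R : realFieldType.

Definition record_prob i : R := avg i (fun w => (row_record w)%:R).
Definition nonpos_prob i : R := avg i (fun w => (row_nonpos w)%:R).

Lemma record_prob_ge0 i : 0 <= record_prob i.
Proof. by apply: avg_ge0 => w _; rewrite ler0n. Qed.

Lemma nonpos_prob_ge0 i : 0 <= nonpos_prob i.
Proof. by apply: avg_ge0 => w _; rewrite ler0n. Qed.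

(** The average is invariant under reversal and mirroring; the factor 4 pays for the added right
    step. *)
Lemma nonpos_prob_le i : nonpos_prob i <= 4 * record_prob i.+1.
Proof.
have p0 a : 0 <= avg i (fun w => (row_record (rcons w a))%:R) :> R.
  by apply: avg_ge0 => w _; rewrite ler0n.
apply: (@le_trans _ _ (avg i (fun w => (row_record (rcons w Rt))%:R))); last first.
  by rewrite /record_prob avgS_rcons; have := p0 Up; have := p0 Lt; have := p0 Dn; lra.
rewrite -[leRHS]avg_rev -[leRHS]avg_mirror.
apply: avg_le => w _; rewrite ler_nat.
by case E : (row_nonpos w) => //; rewrite row_record_rev.
Qed.

(** Union bound over the cutting time; the two pieces of a uniform word are independent. *)
Lemma return_prob_le k : avg k (fun w => (Y w == 0)%:R) <=
  \sum_(i < k.+1) record_prob i * nonpos_prob (k - i)%N.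
Proof.
pose Q (i : 'I_k.+1) w := row_record (take i w) && row_nonpos (drop i w).
apply: le_trans (@avg_union_bound R k _ (index_enum 'I_k.+1) Q (fun w => Y w == 0) _) _.
  move=> w sw /eqP/row_decomposition[i]; rewrite sw -ltnS => ik H.
  by apply/hasP; exists (Ordinal ik); rewrite ?mem_index_enum.
apply: ler_sum => i _.
have -> : avg k (fun w => (Q i w)%:R : R) =
    avg (i + (k - i)) (fun w => (row_record (take i w))%:R * (row_nonpos (drop i w))%:R).
  rewrite subnKC; last by rewrite -ltnS.
  by apply: eq_avg => w _; rewrite -natrM mulnb.
by rewrite (avg_split _ _ (fun w => (row_record w)%:R) (fun w => (row_nonpos w)%:R)).
Qed.

(** Summing the decomposition and using duality bounds the mean number of returns to the row before
    time [t ^ 4] by [4 * S ^ 2], and this number is at least [t ^ 2 / 4]. *)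
Lemma sum_record_ge t : t%:R / 4 <= \sum_(i < (t ^ 4).+1) record_prob i.
Proof.
set n := (t ^ 4)%N; set S := (X in _ <= X).
have S0 : 0 <= S by rewrite sumr_ge0// => i _; exact: record_prob_ge0.
have := sum_return_ge R (t ^ 2)%N; rewrite -expnM -/n => h.
have {}h : (t ^ 2)%:R / 4 <= S * (4 * S).
  apply: le_trans h _.
  apply: (@le_trans _ _ (\sum_(k < n) \sum_(i < k.+1) record_prob i * nonpos_prob (k - i)%N)).
    by apply: ler_sum => k _; exact: return_prob_le.
  apply: le_trans (convolution_le n record_prob_ge0 nonpos_prob_ge0) _.
  apply: ler_pM.
  - by rewrite sumr_ge0// => i _; exact: record_prob_ge0.
  - by rewrite sumr_ge0// => i _; exact: nonpos_prob_ge0.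
  - by rewrite ler_sum_widen//; exact: record_prob_ge0.
  rewrite /S big_ord_recl mulrDr mulr_sumr.
  apply: le_trans (_ : \sum_(i < n) 4 * record_prob i.+1 <= _).
    by apply: ler_sum => i _; exact: nonpos_prob_le.
  by rewrite lerDr mulr_ge0// record_prob_ge0.
rewrite natrX in h; have : 0 <= t%:R :> R by rewrite ler0n.
by move: h; nra.
Qed.

End Duality.

(** * The walk seen from a row, and its renewals *)

(* The walk seen from one row: its height above the row, its abscissa relative
   to a bound [m] for the points visited on the row ([m] is updated when it is
   exceeded), and whether it is now on the row after jumping to [m + 2] or
   further. A left step taken at such a time is called good; it restarts the
   process from [fresh]. *)
Definition row_state := (int * int * bool)%type.

(** A good step is taken at the bound [m] and leads to [m - 1], whence the -1. The same state serves
    at the first visit to a row, with a bound one unit to the right of the walk. *)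
Definition fresh : row_state := (0, -1, false).

Definition good_step (st : row_state) (a : dir) : bool := st.2 && is_left a.

Definition row_step (st : row_state) (a : dir) : row_state :=
  if good_step st a then fresh else
  let v := st.1.1 + (dvec a).2 in
  let g := st.1.2 + (dvec a).1 in
  if (v == 0) && (0 < g) then (0, 0, 1 < g) else (v, g, false).

Fixpoint row_goods (st : row_state) (w : seq dir) : nat :=
  if w is a :: w' then (good_step st a + row_goods (row_step st a) w')%N else 0%N.

(** The argument [b] is the answer for the empty word: with [true], time 0 counts as a renewal. *)
Fixpoint ends_good (b : bool) (st : row_state) (w : seq dir) : bool :=
  if w is a :: w' then ends_good (good_step st a) (row_step st a) w' else b.

Lemma ends_good_cat b st u v : ends_good b st (u ++ v) =
  ends_good (ends_good b st u) (foldl row_step st u) v.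
Proof. by elim: u b st => //= a u IH b st; rewrite IH. Qed.

Definition no_good st w : bool := row_goods st w == 0%N.

(** The bound kept by the process is [X w - g]. It is 1 at first, because [fresh] has [g = -1], and
    it is only ever raised to an abscissa reached on the row. This allows a record to be compared
    with the bound. *)
Lemma foldl_row_step w : let: (v, g, s) := foldl row_step fresh w in
  [/\ v = Y w, s -> v = 0 /\ g = 0 &
   X w - g <= 1 \/ exists k, [/\ (k <= size w)%N, Y (take k w) = 0 &
                                 X w - g <= X (take k w)]].
Proof.
elim/last_ind: w => [|w a]; first by rewrite /= X_nil Y_nil; split=> //; left.
rewrite foldl_rcons; case: (foldl row_step fresh w) => [[v g] s] [Ev Es H].
rewrite X_rcons Y_rcons.
have {}H : X w - g <= 1 \/ exists k, [/\ (k <= size (rcons w a))%N, Y (take k (rcons w a)) = 0 &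
                                 X w - g <= X (take k (rcons w a))].
  case: H => [|[k [kw Yk Xk]]]; [by left | right; exists k].
  by rewrite size_rcons leqW// -cats1 takel_cat.
rewrite /row_step /good_step /=; case: (boolP (s && is_left a)) => [/andP[/Es[v0 g0] al]|_].
  split => //; first by case: a al {H} => //= _; rewrite addr0 -Ev v0.
  case: a al H => //= _; rewrite g0 subr0 => -[h|[k [? ? ?]]]; first by left; lia.
  by right; exists k; split => //; lia.
case: (boolP ((v + (dvec a).2 == 0) && (0 < g + (dvec a).1))) => [/andP[/eqP v0 g0]|_].
  split=> //; first by rewrite -Ev.
  right; exists (size (rcons w a)); rewrite take_size X_rcons Y_rcons -Ev leqnn.
  by split=> //; lia.
split=> //; first by rewrite -Ev.
case: H => [h|[k [? ? ?]]]; first by left; lia.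
by right; exists k; split=> //; lia.
Qed.

(* From a record, the detour above the row gains at least the 2 columns required
   for a good step, even from [fresh]. *)
Lemma ends_good_record w :
  row_record w -> ends_good true fresh (w ++ [:: Up; Rt; Rt; Rt; Dn; Lt]).
Proof.
move=> /row_recordP[Yw H]; rewrite ends_good_cat.
have := foldl_row_step w; case: (foldl row_step fresh w) => [[v g] s] [Ev _ Hg].
(* A nonempty record is to the right of time 0, and not to the left of any visit, so the bound
   exceeds [X w] by at most 1. Three right steps then bring [g] to at least 2. *)
have g1 : -1 <= g.
  have : X w = 0 /\ w = [::] \/ 0 < X w.
    case: {Ev Hg} w Yw H => [|a w] Yw H; first by left; rewrite X_nil.
    by right; have := H 0%N isT; rewrite take0 X_nil Y_nil; apply.
  case: Hg => [|[k [kw Yk Xk]]]; first by lia.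
  move: kw; rewrite leq_eqVlt => /orP[/eqP Ek|kw]; first by move: Xk; rewrite Ek take_size; lia.
  by have := H _ kw Yk; lia.
have up s' g' : row_step (0, g', s') Up = (1, g', false).
  by rewrite /row_step /good_step andbF /= addr0.
have rt g' : row_step (1, g', false) Rt = (1, g' + 1, false) by [].
have dn g' : 1 < g' -> row_step (1, g', false) Dn = (0, 0, true).
  by move=> g'1; rewrite /row_step /= addr0 g'1 ifT//; lia.
have cons b st a u : ends_good b st (a :: u) = ends_good (good_step st a) (row_step st a) u.
  by [].
by rewrite Ev Yw 6!cons up !rt dn//=; lia.
Qed.

Section Renewal.
Variable R : realFieldType.

(** Decomposition at the last good step: the terms with [i > 0] contain exactly one 1 if some step
    is good and none otherwise, and the term [i = 0] is [b && no_good fresh w]. *)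
Lemma renewal_identity (b : bool) st w :
  \sum_(i < (size w).+1) (ends_good b st (take i w) && no_good fresh (drop i w))%:R
    = (b && no_good fresh w)%:R + 1 - (no_good st w)%:R :> R.
Proof.
elim: w b st => [|a w IH] b st.
  by rewrite big_ord_recl big_ord0 /= addr0 addrK.
rewrite big_ord_recl /= -addrA; congr (_ + _).
rewrite (eq_bigr (fun i : 'I_(size w).+1 => (ends_good (good_step st a)
  (row_step st a) (take i w) && no_good fresh (drop i w))%:R))//.
rewrite IH /no_good /=; case E: (good_step st a) => /=.
  by rewrite /row_step E; lra.
by rewrite add0n; lra.
Qed.

Definition good_prob i : R := avg i (fun w => (ends_good true fresh w)%:R).
Definition survival i : R := avg i (fun w => (no_good fresh w)%:R).

Lemma good_prob_ge0 i : 0 <= good_prob i.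
Proof. by apply: avg_ge0 => w _; rewrite ler0n. Qed.

Lemma survival_ge0 i : 0 <= survival i.
Proof. by apply: avg_ge0 => w _; rewrite ler0n. Qed.

(** Time 0 being a renewal, there is exactly one last renewal up to time [n]; what precedes it and
    what follows it are independent. *)
Lemma renewal n : \sum_(i < n.+1) good_prob i * survival (n - i)%N = 1.
Proof.
rewrite -[RHS](avg_cst n).
rewrite -[RHS](@eq_avg R n (fun w => \sum_(i < n.+1)
    (ends_good true fresh (take i w))%:R * (no_good fresh (drop i w))%:R)); last first.
  move=> w sw; have := renewal_identity true fresh w.
  rewrite sw /= addrAC subrr add0r => E; rewrite -[RHS]E.
  by apply: eq_bigr => i _; rewrite -mulnb natrM.
rewrite avg_sum; apply: eq_bigr => i _.
rewrite -(avg_split _ _ (fun w => (ends_good true fresh w)%:R) (fun w => (no_good fresh w)%:R)).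
by rewrite subnKC// -ltnS.
Qed.

(** A record is turned into a good step by the detour of 6 prescribed directions. *)
Lemma good_prob_ge i : record_prob R i / 4 ^+ 6 <= good_prob (i + 6).
Proof.
rewrite /good_prob avg_cat -avgZr; apply: avg_le => w _.
case E : (row_record w); last by rewrite mul0r avg_ge0.
have := @avg_ge_word R (fun v => (ends_good true fresh (w ++ v))%:R)
  [:: Up; Rt; Rt; Rt; Dn; Lt] (fun=> ler0n _ _).
by rewrite ends_good_record.
Qed.

(** With [n = t ^ 4], the renewal identity bounds the product of the summed good-step and survival
    probabilities by a multiple of [n]. The first factor is at least of order [t], so the truncated
    mean waiting time is at most of order [n / t]. *)
Lemma sum_survival_le t : (0 < t)%N ->
  t%:R * \sum_(k < t ^ 4) survival k <= 4 ^+ 9 * (t ^ 4)%:R.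
Proof.
move=> t0; set n := (t ^ 4)%N; set S := \sum_(k < n) _.
have n0 : (0 < n)%N by rewrite expn_gt0 t0.
(* Room for the [n.+1] terms of the record sum, shifted by the 6 steps of the detour. *)
set N := (n + 7)%N.
have S0 : 0 <= S by rewrite sumr_ge0// => i _; exact: survival_ge0.
have SN : S <= \sum_(k < N) survival k.
  by rewrite ler_sum_widen ?leq_addr//; exact: survival_ge0.
have := convolution_ge N good_prob_ge0 survival_ge0.
have -> : \sum_(k < N + N) \sum_(i < k.+1) good_prob i * survival (k - i)%N = (N + N)%:R.
  by rewrite (eq_bigr (fun=> 1)) => [|k _]; [rewrite sumr_const card_ord | exact: renewal].
move=> h.
have G : t%:R / 4 / 4 ^+ 6 <= \sum_(i < N) good_prob i.
  apply: (@le_trans _ _ (\sum_(i < n.+1) good_prob (i + 6))).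
    apply: (@le_trans _ _ (\sum_(i < n.+1) record_prob R i / 4 ^+ 6)).
      rewrite -mulr_suml ler_wpM2r ?invr_ge0 ?exprn_ge0//.
      exact: sum_record_ge.
    by apply: ler_sum => i _; exact: good_prob_ge.
  rewrite -(big_mkord xpredT (fun i => good_prob (i + 6))) -(big_mkord xpredT good_prob).
  rewrite (@big_cat_nat _ _ _ 6 0 N)//=; last by rewrite /N; lia.
  have -> : \sum_(6 <= i < N) good_prob i = \sum_(0 <= i < n.+1) good_prob (i + 6).
    by rewrite -{1}[6%N]add0n big_addn (_ : (N - 6)%N = n.+1)//; rewrite /N; lia.
  by rewrite lerDr sumr_ge0// => i _; exact: good_prob_ge0.
have : t%:R / 4 / 4 ^+ 6 * S <= (N + N)%:R.
  have g0 : 0 <= t%:R / 4 / 4 ^+ 6 :> R by have := ler0n R t; lra.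
  by apply: le_trans h; apply: ler_pM.
have : (N + N)%:R <= 16 * n%:R :> R.
  by rewrite -natrM ler_nat /N; lia.
lra.
Qed.

End Renewal.

(** * Waiting for good steps *)

(** The time of the [h]-th good step, truncated at the length of the word. *)
Fixpoint waiting (h : nat) (st : row_state) (w : seq dir) : nat :=
  if h is h'.+1 then
    if w is a :: w' then
      (waiting (if good_step st a then h' else h) (row_step st a) w').+1
    else 0
  else 0.

(* Only meaningful for [v != 0]: the walk is at height [v] above a row that it has
   not visited yet. *)
Fixpoint new_row_goods (v : int) (w : seq dir) : nat :=
  if w is a :: w' then
    if v + (dvec a).2 == 0 then row_goods fresh w'
    else new_row_goods (v + (dvec a).2) w'
  else 0.

Fixpoint new_row_waiting (h : nat) (v : int) (w : seq dir) : nat :=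
  if w is a :: w' then
    (if v + (dvec a).2 == 0 then waiting h fresh w'
     else new_row_waiting h (v + (dvec a).2) w').+1
  else 0.

Lemma waiting_size h st w : (row_goods st w < h)%N -> waiting h st w = size w.
Proof.
elim: w h st => [|a w IH] [|h] st //=; case: (good_step st a) => /=.
  by rewrite add1n ltnS => /IH ->.
by rewrite add0n => /IH ->.
Qed.

Lemma new_row_waiting_size h v w :
  (new_row_goods v w < h)%N -> new_row_waiting h v w = size w.
Proof.
elim: w v => //= a w IH v; case: eqP => _; last by move/IH ->.
by move/waiting_size ->.
Qed.

Lemma new_row_waiting_le h v w : (new_row_waiting h v w <= size w)%N.
Proof.
have W g st u : (waiting g st u <= size u)%N.
  by elim: u g st => [|a u IH] [|g] st //=; rewrite ltnS.
by elim: w v => //= a w IH v; case: eqP => _; rewrite ltnS.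
Qed.

Lemma waiting1 st w : waiting 1 st w = (\sum_(k < size w) no_good st (take k w))%N.
Proof.
elim: w st => [|a w IH] st; first by rewrite big_ord0.
rewrite big_ord_recl /= /no_good /=; case E: (good_step st a) => /=.
  by rewrite big1 => [|i _]; rewrite ?addn0//; case: w {IH}.
by rewrite IH -add1n; congr (1 + _)%N; apply: eq_bigr.
Qed.

Section ExpectedWaiting.
Variable R : realFieldType.

Definition expected_waiting n h st : R := avg n (fun w => (waiting h st w)%:R).

Lemma expected_waitingS n h st : expected_waiting n.+1 h.+1 st = 1 +
  (expected_waiting n (if good_step st Rt then h else h.+1) (row_step st Rt) +
   expected_waiting n (if good_step st Up then h else h.+1) (row_step st Up) +
   expected_waiting n (if good_step st Lt then h else h.+1) (row_step st Lt) +
   expected_waiting n (if good_step st Dn then h else h.+1) (row_step st Dn)) / 4.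
Proof.
have E a : avg n (fun w => (waiting h.+1 st (a :: w))%:R) = 1 +
    expected_waiting n (if good_step st a then h else h.+1) (row_step st a).
  rewrite /expected_waiting -[X in _ = X + _](avg_cst n) -avgD.
  by apply: eq_avg => w _; rewrite /= -natr1 addrC.
by rewrite {1}/expected_waiting avgS !E; lra.
Qed.

Lemma expected_waiting0 n st : expected_waiting n 0 st = 0.
Proof. by rewrite -[RHS](avg_cst n); apply: eq_avg => -[]. Qed.

Lemma expected_waiting_ge0 n h st : 0 <= expected_waiting n h st.
Proof. by apply: avg_ge0 => w _; rewrite ler0n. Qed.

Lemma expected_waiting_mono m n h st : (m <= n)%N ->
  expected_waiting m h st <= expected_waiting n h st.
Proof.
suff S k g s : expected_waiting k g s <= expected_waiting k.+1 g s.
  by move=> /subnK <-; elim: (n - m)%N => //= d IH; apply: le_trans IH (S _ _ _).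
elim: k g s => [|k IH] g s.
  have -> : expected_waiting 0 g s = 0 by case: g.
  exact: expected_waiting_ge0.
case: g => [|g]; first by rewrite !expected_waiting0.
rewrite !expected_waitingS lerD2l ler_wpM2r ?invr_ge0//.
by rewrite !lerD.
Qed.

(* Strong Markov property at the first good step. *)
Lemma expected_waiting_add n h st : expected_waiting n h.+1 st <=
  expected_waiting n 1 st + expected_waiting n h fresh.
Proof.
elim: n h st => [|n IH] h st.
  have -> : expected_waiting 0 h.+1 st = 0 by [].
  by rewrite addr_ge0 ?expected_waiting_ge0.
set c := expected_waiting n.+1 h fresh.
rewrite !expected_waitingS.
have E a : expected_waiting n (if good_step st a then h else h.+1) (row_step st a) <=
    expected_waiting n (if good_step st a then 0%N else 1%N) (row_step st a) + c.
  case Ea : (good_step st a).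
    rewrite expected_waiting0 add0r /row_step Ea.
    exact: expected_waiting_mono.
  apply: le_trans (IH _ _) _; rewrite lerD2l.
  exact: expected_waiting_mono.
by have := E Rt; have := E Up; have := E Lt; have := E Dn; lra.
Qed.

(** The process restarts after each good step, and the mean of one truncated wait is the sum of its
    tail probabilities. *)
Lemma expected_waiting_fresh n h : expected_waiting n h fresh <=
  h%:R * \sum_(k < n) survival R k.
Proof.
have E1 : expected_waiting n 1 fresh = \sum_(k < n) survival R k.
  rewrite /expected_waiting (@eq_avg R n _ (fun w => \sum_(k < n) (no_good fresh (take k w))%:R)).
    rewrite avg_sum; apply: eq_bigr => k _.
    have kn : n = (k + (n - k))%N by rewrite subnKC// ltnW.
    by rewrite {1}kn (avg_take k _ (fun w => (no_good fresh w)%:R)).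
  by move=> w sw; rewrite waiting1 sw natr_sum.
elim: h => [|h IH]; first by rewrite expected_waiting0 mul0r.
by apply: le_trans (expected_waiting_add _ _ _) _; rewrite -natr1 E1 mulrDl mul1r; lra.
Qed.

(** Stop the vertical distance to the row when it is 0 or [r]. As it moves with probability 1/2 at
    each step, this takes [2 y (r - y)] steps in mean; it ends at [r] with probability [y / r], at a
    cost of at most [N] steps, and otherwise the wait on the row begins. The induction checks that
    the sum of these costs bounds the mean. *)
Lemma avg_new_row_waiting N n (r y h : nat) : (0 < r)%N -> (0 < y)%N -> (n <= N)%N ->
  avg n (fun w => (new_row_waiting h (- y%:Z) w)%:R) <=
  2 * y%:R * r%:R + N%:R * y%:R / r%:R + expected_waiting N h fresh.
Proof.
move=> r0 y0 nN; set W := expected_waiting N h fresh.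
have W0 : 0 <= W by exact: expected_waiting_ge0.
have rR : 0 < r%:R :> R by rewrite ltr0n.
pose s : R := N%:R / r%:R.
have sr : s * r%:R = N%:R by rewrite /s divfK// gt_eqF.
have s0 : 0 <= s by rewrite divr_ge0.
have far k z : (r <= z)%N -> (k <= N)%N ->
    avg k (fun w => (new_row_waiting h (- z%:Z) w)%:R) <= s * z%:R :> R.
  move=> rz kN; apply: (@le_trans _ _ N%:R).
    rewrite -[leRHS](avg_cst k); apply: avg_le => w sw; rewrite ler_nat.
    by rewrite (leq_trans (new_row_waiting_le _ _ _))// sw.
  by rewrite -sr ler_wpM2l// ler_nat.
have near k z : (z < r)%N -> (k <= N)%N ->
    avg k (fun w => (new_row_waiting h (- z.+1%:Z) w)%:R) <=
      2 * z.+1%:R * (r%:R - z.+1%:R) + s * z.+1%:R + W :> R.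
  elim: k z => [|k IH] z zr kN.
    have : z.+1%:R <= r%:R :> R by rewrite ler_nat.
    move=> h1; have : 0 <= 2 * z.+1%:R * (r%:R - z.+1%:R) :> R by rewrite !mulr_ge0// subr_ge0.
    have : 0 <= s * z.+1%:R by exact: mulr_ge0.
    by rewrite /=; lra.
  move: zr; rewrite leq_eqVlt => /orP[/eqP zr|zr].
    apply: le_trans (far _ _ _ kN) _; first by rewrite zr.
    by rewrite -zr subrr mulr0 add0r; lra.
  have {}IH z' := IH z' ^~ (ltnW kN).
  have E a : avg k (fun w => (new_row_waiting h (- z.+1%:Z) (a :: w))%:R) = 1 +
      avg k (fun w => (if - z.+1%:Z + (dvec a).2 == 0 then waiting h fresh w
        else new_row_waiting h (- z.+1%:Z + (dvec a).2) w)%:R) :> R.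
    rewrite -[X in _ = X + _](avg_cst k) -avgD.
    by apply: eq_avg => w _; rewrite /= -natr1 addrC.
  have Eh b : (dvec b).2 = 0 -> avg k (fun w => (new_row_waiting h (- z.+1%:Z) (b :: w))%:R) <=
     1 + (2 * z.+1%:R * (r%:R - z.+1%:R) + s * z.+1%:R + W).
    by move=> b0; rewrite E b0 addr0 /= lerD2l IH// ltnW.
  have Ed : avg k (fun w => (new_row_waiting h (- z.+1%:Z) (Dn :: w))%:R) <=
     1 + (2 * (z.+1%:R + 1) * (r%:R - (z.+1%:R + 1)) + s * (z.+1%:R + 1) + W).
    rewrite E /= (_ : - z.+1%:Z + -1 = - z.+2%:Z); last by lia.
    by rewrite lerD2l natr1 IH.
  have Eu : avg k (fun w => (new_row_waiting h (- z.+1%:Z) (Up :: w))%:R) <=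
     1 + (2 * (z.+1%:R - 1) * (r%:R - (z.+1%:R - 1)) + s * (z.+1%:R - 1) + W).
    rewrite E /= lerD2l; case: z zr E Eh Ed => [|z] zr E Eh Ed.
      rewrite /= subrr mulr0 mul0r mulr0 !add0r.
      exact: expected_waiting_mono (ltnW kN).
    rewrite (_ : - z.+2%:Z + 1 = - z.+1%:Z); last by lia.
    by rewrite -[z.+2%:R]natr1 addrK IH// ltnW// ltnW.
  by rewrite avgS; have := Eh Rt erefl; have := Eh Lt erefl; lra.
have yR : 0 <= y%:R :> R by [].
have -> : N%:R * y%:R / r%:R = s * y%:R by rewrite /s mulrAC.
have [ry|yr] := leqP r y.
  apply: le_trans (far _ _ ry nN) _.
  have : 0 <= 2 * y%:R * r%:R :> R by rewrite !mulr_ge0.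
  lra.
case: y y0 yR yr => // y _ yR yr; apply: le_trans (near _ _ (ltnW yr) nN) _.
by have := mulr_ge0 yR yR; lra.
Qed.

(** Markov's inequality for the waiting time. With [t = m ^ q], [n = t ^ 4] and barrier [t ^ 2],
    reaching a row at distance [y <= t ^ 2 / m] and then waiting for [t / m] good steps both take a
    mean time of order [n / m]. *)
Lemma avg_few_row_goods (m q y : nat) : (0 < m)%N -> (0 < q)%N -> (0 < y)%N ->
  (y <= m ^ (2 * q - 1))%N ->
  m%:R * avg (m ^ (4 * q)) (fun w => (new_row_goods (- y%:Z) w < m ^ (q - 1))%N%:R)
    <= 4 ^+ 10 :> R.
Proof.
case: q => // q m0 _ y0 yK; set t := (m ^ q.+1)%N; set h := (m ^ (q.+1 - 1))%N.
have t0 : (0 < t)%N by rewrite expn_gt0 m0.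
have -> : (m ^ (4 * q.+1) = t ^ 4)%N by rewrite -expnM mulnC.
set n := (t ^ 4)%N; set p := avg _ _.
have mh : (m * h = t)%N by rewrite /h subn1 /= -expnS.
have my : (m * y <= t ^ 2)%N.
  apply: (@leq_trans (m * m ^ (2 * q.+1 - 1))%N); first by rewrite leq_mul2l yK orbT.
  by rewrite -expnS -expnM leq_pexp2l//; lia.
have T2 : (0 < t ^ 2)%N by rewrite expn_gt0 t0.
have := @avg_new_row_waiting n n (t ^ 2) y h T2 y0 (leqnn n).
have := expected_waiting_fresh n h; have := sum_survival_le R t0.
rewrite -/n; set S := \sum_(k < n) _; set W := expected_waiting _ _ _ => hS hW hA.
have hp : p * n%:R <= avg n (fun w => (new_row_waiting h (- y%:Z) w)%:R).
  rewrite -avgZr; apply: avg_le => w sw; case: ltnP => hh; last by rewrite mul0r.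
  by rewrite mul1r new_row_waiting_size ?sw.
have nR : 0 < n%:R :> R by rewrite ltr0n expn_gt0 t0.
rewrite -(ler_pM2r nR) -mulrA.
apply: (@le_trans _ _ (m%:R * (2 * y%:R * (t ^ 2)%:R + n%:R * y%:R / (t ^ 2)%:R + W))).
  by rewrite ler_wpM2l// (le_trans hp).
have T2R : 0 < (t ^ 2)%:R :> R by rewrite ltr0n.
have nE : n%:R = (t ^ 2)%:R * (t ^ 2)%:R :> R by rewrite -natrM -expnD.
have -> : n%:R * y%:R / (t ^ 2)%:R = y%:R * (t ^ 2)%:R :> R.
  by rewrite nE mulrAC mulrK ?unitfE ?gt_eqF// mulrC.
have h1 : m%:R * y%:R * (t ^ 2)%:R <= n%:R :> R.
  by rewrite -!natrM ler_nat /n -[4%N]/(2 + 2)%N expnD leq_mul2r my orbT.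
have h2 : m%:R * W <= 4 ^+ 9 * n%:R.
  apply: le_trans hS; rewrite -mh natrM -mulrA ler_wpM2l//.
move: h1 h2; rewrite (exprS (4 : R) 9); set z : R := 4 ^+ 9 => h1 h2.
have : 1 <= z by rewrite exprn_ege1//; lra.
nra.
Qed.

(** If the total is below half of [K * h], at least half of the [K] rows have fewer than [h] good
    steps; Markov's inequality applies to the number of such rows. *)
Lemma avg_few_goods (m q : nat) : (0 < m)%N -> (0 < q)%N ->
  m%:R * avg (m ^ (4 * q)) (fun w =>
      (2 * \sum_(y < m ^ (2 * q - 1)) new_row_goods (- y.+1%:Z) w <
       m ^ (2 * q - 1) * m ^ (q - 1))%N%:R) <= 4 ^+ 11 :> R.
Proof.
move=> m0 q0; set K := (m ^ (2 * q - 1))%N; set h := (m ^ (q - 1))%N.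
set n := (m ^ (4 * q))%N.
have K0 : (0 < K)%N by rewrite expn_gt0 m0.
have KR : 0 < K%:R :> R by rewrite ltr0n.
set p := avg _ _.
have : p * K%:R <= 2 * \sum_(y < K) avg n (fun w => (new_row_goods (- y.+1%:Z) w < h)%N%:R).
  rewrite -avg_sum -avgZr -avgZ; apply: avg_le => w _.
  case: ltnP => hw; last by rewrite mul0r mulr_ge0// sumr_ge0.
  rewrite mul1r -natr_sum -natrM ler_nat.
  have : (K * h <= \sum_(y < K) new_row_goods (- y.+1%:Z) w +
      (\sum_(y < K) (new_row_goods (- y.+1%:Z) w < h)%N) * h)%N.
    rewrite big_distrl -big_split /= -[X in (X * h)%N]card_ord -sum_nat_const.
    by apply: leq_sum => y _; case: ltnP => hy /=; lia.
  by set a := (\sum_(y < K) new_row_goods _ _)%N; set b := (\sum_(y < K) _)%N; nia.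
move=> hp; rewrite -(ler_pM2r KR) -mulrA.
apply: (@le_trans _ _ (m%:R * (2 * \sum_(y < K)
    avg n (fun w => (new_row_goods (- y.+1%:Z) w < h)%N%:R)))).
  by rewrite ler_wpM2l.
rewrite mulrCA mulr_sumr.
apply: (@le_trans _ _ (2 * \sum_(y < K) 4 ^+ 10)).
  rewrite ler_wpM2l//; apply: ler_sum => y _.
  by apply: avg_few_row_goods => //; exact: ltn_ord.
rewrite sumr_const card_ord -[_ *+ K]mulr_natr (exprS (4 : R) 10).
have : 0 <= 4 ^+ 10 :> R by rewrite exprn_ge0.
nra.
Qed.

End ExpectedWaiting.

(** * Coupling of the growing walk with the simple random walk *)

Definition strong_record (u : seq dir) : bool :=
  all (fun k => (Y (take k u) == Y u) ==> (X (take k u) + 2 <= X u)) (iota 0 (size u)).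

Lemma strong_recordP u : reflect
  (forall k, (k < size u)%N -> Y (take k u) = Y u -> X (take k u) + 2 <= X u)
  (strong_record u).
Proof.
apply: (iffP allP) => H k; last by rewrite mem_iota /= => ku; apply/implyP => /eqP; exact: H.
by move=> ku Yk; have := H k; rewrite mem_iota /= add0n ku Yk eqxx => /(_ isT).
Qed.

Definition good_at (w : seq dir) (i : nat) : bool :=
  is_left (nth Rt w i) && strong_record (take i w).

Definition goods (w : seq dir) : nat := count (good_at w) (iota 0 (size w)).

Definition goods_on (y : int) (w : seq dir) (i n : nat) : nat :=
  count (fun k => good_at w k && (Y (take k w) == y)) (iota i n).

(** The state is that of row [y] after the prefix [u]. The bound [m] need not be attained, so the
    row process may miss some strong records, but every good step that it counts is one of the
    word. *)
Lemma row_goods_le (y m : int) (s : bool) u w :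
  (forall k, (k <= size u)%N -> Y (take k u) = y -> X (take k u) <= m) ->
  (s -> [/\ Y u = y, X u = m & strong_record u]) ->
  (row_goods (Y u - y, X u - m, s)%R w <= goods_on y (u ++ w) (size u) (size w))%N.
Proof.
elim: w u m s => // a w IH u m s Hm Hs; rewrite /goods_on /= -/(goods_on _ _ _ _).
have tu : take (size u) (u ++ a :: w) = u by rewrite take_size_cat.
have au : nth Rt (u ++ a :: w) (size u) = a by rewrite nth_cat ltnn subnn.
apply: leq_add.
  rewrite /good_step /=; case: s Hs => // /(_ isT)[Yu _ Su].
  by rewrite /good_at au tu Su Yu eqxx !andbT.
rewrite -cat_rcons -(size_rcons u a).
have Hm' k : (k <= size u)%N -> Y (take k (rcons u a)) = y -> X (take k (rcons u a)) <= m.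
  by move=> ku; rewrite -cats1 takel_cat//; exact: Hm.
have tr : take (size u).+1 (rcons u a) = rcons u a by rewrite -(size_rcons u a) take_size.
have -> : row_step (Y u - y, X u - m, s) a =
   if good_step (Y u - y, X u - m, s) a then fresh else
   if (Y (rcons u a) - y == 0) && (0 < X (rcons u a) - m) then (0, 0, 1 < X (rcons u a) - m)
   else (Y (rcons u a) - y, X (rcons u a) - m, false).
  by rewrite /row_step Y_rcons X_rcons /= !(addrAC _ (dvec a).1) !(addrAC _ (dvec a).2).
case: ifP => [/andP[/= /Hs[Yu Xu Su] al]|_].
  have [Ya Xa] : Y (rcons u a) = y /\ X (rcons u a) = m - 1.
    by rewrite Y_rcons X_rcons Yu Xu; case: a al {Hm' tr au tu} => //= _; rewrite addr0.
  have -> : fresh = (Y (rcons u a) - y, X (rcons u a) - m, false).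
    by rewrite Ya Xa subrr addrAC subrr add0r.
  apply: IH => // k; rewrite size_rcons leq_eqVlt => /orP[/eqP ->|]; last exact: Hm'.
  by rewrite tr Xa; lia.
case: ifP => [/andP[/eqP Ya Xa]|H].
  set b := (1 < _); have -> : (0, 0, b) =
      (Y (rcons u a) - y, X (rcons u a) - X (rcons u a), b) by rewrite Ya subrr.
  apply: IH => [k|].
    rewrite size_rcons leq_eqVlt => /orP[/eqP ->|ku Yk]; first by rewrite tr.
    by have := Hm' _ ku Yk; lia.
  rewrite /b => b1; split=> //; first by lia.
  apply/strong_recordP => k; rewrite size_rcons => ku Yk.
  by have := Hm' k ku; rewrite Yk; lia.
apply: IH => // k; rewrite size_rcons leq_eqVlt => /orP[/eqP ->|]; last exact: Hm'.
by rewrite tr => Ya; move: H; rewrite Ya subrr eqxx /=; lia.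
Qed.

Lemma new_row_goods_le (y : int) u w :
  (forall k, (k <= size u)%N -> Y (take k u) != y) ->
  (new_row_goods (Y u - y)%R w <= goods_on y (u ++ w) (size u) (size w))%N.
Proof.
elim: w u => // a w IH u Hu; rewrite /goods_on /= -/(goods_on _ _ _ _).
apply: leq_trans (leq_addl _ _); rewrite -cat_rcons -(size_rcons u a).
have Hu' k : (k <= size u)%N -> Y (take k (rcons u a)) != y.
  by move=> ku; rewrite -cats1 takel_cat//; exact: Hu.
have tr : take (size u).+1 (rcons u a) = rcons u a by rewrite -(size_rcons u a) take_size.
rewrite addrAC -Y_rcons; case: eqP => Ya.
  have -> : fresh = (Y (rcons u a) - y, X (rcons u a) - (X (rcons u a) + 1), false).
    by rewrite Ya opprD addrA subrr sub0r.
  apply: row_goods_le => // k; rewrite size_rcons leq_eqVlt => /orP[/eqP ->|ku Yk].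
    by rewrite tr; lia.
  by have := Hu' k ku; rewrite Yk eqxx.
apply: IH => k; rewrite size_rcons leq_eqVlt => /orP[/eqP ->|]; last exact: Hu'.
by rewrite tr; apply/eqP => E; apply: Ya; rewrite E subrr.
Qed.

Lemma sum_new_row_goods_le K w :
  (\sum_(y < K) new_row_goods (- y.+1%:Z) w <= goods w)%N.
Proof.
apply: (@leq_trans (\sum_(y < K) goods_on y.+1%:Z w 0 (size w))).
  apply: leq_sum => y _; have := @new_row_goods_le y.+1%:Z [::] w.
  by rewrite Y_nil sub0r /=; apply=> -[].
apply: (@leq_trans (count (fun k => good_at w k && (0 < Y (take k w) <= K%:Z)) (iota 0 (size w)))).
  elim: K => [|K IH]; first by rewrite big_ord0.
  rewrite big_ord_recr /=; apply: leq_trans (leq_add IH (leqnn _)) _.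
  rewrite /goods_on -count_predUI [X in (_ + X)%N](_ : _ = 0%N) ?addn0.
    by apply: sub_count => k /orP[] /andP[gk h]; rewrite /= gk /=; lia.
  apply/eqP; rewrite -leqn0 leqNgt -has_count; apply/hasPn => k _ /=.
  by case: (good_at w k) => //=; lia.
by apply: sub_count => k /andP[].
Qed.

(* [c x] means that the edge from [x - e1] to [x] belongs to the initial graph.
   A path is the list of the successive positions, a site that is new being
   listed twice. The walk [run] follows the uniform directions [w], except that
   it ignores a left step along an edge which is not available. *)
Definition blocked (c : int * int -> bool) (p : seq (int * int)) (a : dir) : bool :=
  [&& is_left a, ~~ c (last 0 p) & last 0 p + dvec a \notin p].

Definition move (c : int * int -> bool) (p : seq (int * int)) (a : dir) :=
  let z := last 0 p + dvec a in
  if blocked c p a then p else if z \in p then rcons p z else rcons (rcons p z) z.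

Definition run c (p : seq (int * int)) (w : seq dir) := foldl (move c) p w.

Definition start : seq (int * int) := [:: 0; 0].

Definition stall c w i : bool := blocked c (run c start (take i w)) (nth Rt w i).

Definition loc c w i : int * int := last 0 (run c start (take i w)).

Definition stalls c w : bitseq := mkseq (stall c w) (size w).

(** Defined for an arbitrary stall pattern [b]: in a union bound over patterns, the sites then do
    not depend on the initial graph. *)
Definition shifted (w : seq dir) (b : bitseq) (i : nat) : int * int :=
  pos (take i w) + ((count id (take i b))%:Z, 0).

Lemma run_takeS c w i : (i < size w)%N ->
  run c start (take i.+1 w) = move c (run c start (take i w)) (nth Rt w i).
Proof. by move=> iw; rewrite (take_nth Rt iw) /run foldl_rcons. Qed.

Lemma move_last c p a : last 0 (move c p a) =
  if blocked c p a then last 0 p else last 0 p + dvec a.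
Proof. by rewrite /move; case: ifP => // _; case: ifP; rewrite !last_rcons. Qed.

Lemma locS c w i : (i < size w)%N -> loc c w i.+1 =
  if stall c w i then loc c w i else loc c w i + dvec (nth Rt w i).
Proof. by move=> iw; rewrite /loc run_takeS// move_last. Qed.

Lemma count_takeS (b : bitseq) i : (i < size b)%N ->
  count id (take i.+1 b) = (count id (take i b) + nth false b i)%N.
Proof. by move=> ib; rewrite (take_nth false ib) -cats1 count_cat /= addn0. Qed.

(** Only left steps stall, and ignoring one amounts to adding [(1, 0)]. *)
Lemma locE c w i : (i <= size w)%N -> loc c w i = shifted w (stalls c w) i.
Proof.
elim: i => [|i IH] iw; first by rewrite /loc /shifted !take0 pos_nil addr0.
rewrite locS// /shifted (take_nth Rt iw) pos_rcons count_takeS ?size_mkseq// nth_mkseq//.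
rewrite {}IH ?(ltnW iw)// /shifted.
case E : (stall c w i); last by rewrite addn0 addrAC.
have {E} : is_left (nth Rt w i) by move: E => /and3P[].
by case: nth => // _; apply/eqP; rewrite xpair_eqE /=; lia.
Qed.

Lemma mem_run c w i z : (i <= size w)%N -> z \in run c start (take i w) ->
  exists2 s, (s <= i)%N & z = loc c w s.
Proof.
elim: i => [|i IH] iw.
  by rewrite take0 !inE orbb => /eqP ->; exists 0%N; rewrite // /loc take0.
have [zi|zN] := boolP (z \in run c start (take i w)).
  case: (IH (ltnW iw) zi) => s si -> _.
  by exists s => //; exact: leqW.
move=> zS; exists i.+1 => //.
move: zS; rewrite run_takeS// /loc run_takeS// move_last /move.
case: ifP => _; first by rewrite (negbTE zN).
by case: ifP => _; rewrite !(mem_rcons, inE) (negbTE zN) ?orbF ?orbb => /eqP.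
Qed.

Lemma loc_bound c w i : (i <= size w)%N -> `|(loc c w i).1| <= i%:Z /\ `|(loc c w i).2| <= i%:Z.
Proof.
elim: i => [|i IH] iw; first by rewrite /loc take0.
rewrite locS//; case: (IH (ltnW iw)) => h1 h2.
by case: ifP => _; [|case: nth => /=]; lia.
Qed.

(* Stalls only shift the walk to the right, so that the left neighbor of the
   position at a good step has not been visited. *)
Lemma good_at_open c w i : (i < size w)%N -> good_at w i -> ~~ stall c w i -> c (loc c w i).
Proof.
move=> iw /andP[al /strong_recordP Hs]; rewrite /stall /blocked al /= -/(loc c w i).
rewrite negb_and negbK => /orP[//|]; rewrite negbK.
have -> : dvec (nth Rt w i) = (-1, 0) by case: nth al.
case/(mem_run (ltnW iw)) => s si; rewrite !locE ?(ltnW iw)//; last by apply: leq_trans (ltnW iw).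
rewrite /shifted => /eqP; rewrite xpair_eqE /= -/(X _) -/(X _) -/(Y _) -/(Y _) !addr0 =>
  /andP[/eqP Ex /eqP Ey].
have cnt : (count id (take s (stalls c w)) <= count id (take i (stalls c w)))%N.
  by rewrite -(subnKC si) takeD count_cat leq_addr.
move: si; rewrite leq_eqVlt => /orP[/eqP si|si].
  by move: Ex; rewrite si; lia.
have := Hs s; rewrite size_take iw take_takel ?(ltnW si)// => /(_ si).
by rewrite Ey => /(_ erefl); lia.
Qed.

(** The sites whose left edge has to be in the initial graph if [b] is the actual stall pattern. *)
Definition open_sites (w : seq dir) (b : bitseq) : seq (int * int) :=
  [seq shifted w b i | i <- iota 0 (size w) & good_at w i && ~~ nth false b i].

(** On a given row, a good step is taken strictly to the right of all earlier points of the simple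
    random walk, and the shift is nondecreasing. *)
Lemma open_sites_uniq w b : uniq (open_sites w b).
Proof.
rewrite /open_sites map_inj_in_uniq; first by rewrite filter_uniq// iota_uniq.
suff lt_neq i j : (i < j < size w)%N -> good_at w j -> shifted w b i != shifted w b j.
  move=> i j; rewrite !mem_filter !mem_iota /= => /andP[/andP[gi _] iw] /andP[/andP[gj _] jw] E.
  case: (ltngtP i j) => // ij.
    by have := lt_neq i j; rewrite ij jw E eqxx => /(_ isT gj).
  by have := lt_neq j i; rewrite ij iw E eqxx => /(_ isT gi).
move=> /andP[ij jw] /andP[_ /strong_recordP Hs].
apply/eqP => /eqP; rewrite xpair_eqE /= -/(X _) -/(X _) -/(Y _) -/(Y _) !addr0 =>
  /andP[/eqP Ex /eqP Ey].
have cnt : (count id (take i b) <= count id (take j b))%N.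
  by rewrite -(subnKC (ltnW ij)) takeD count_cat leq_addr.
have := Hs i; rewrite size_take jw take_takel ?(ltnW ij)// => /(_ ij Ey); lia.
Qed.

Lemma size_open_sites w b : size b = size w -> (goods w - count id b <= size (open_sites w b))%N.
Proof.
move=> sb; rewrite size_map size_filter leq_subLR /goods.
have -> : count id b = count (nth false b) (iota 0 (size w)).
  by rewrite -sb -(count_map (nth false b) id) -/(mkseq _ _) mkseq_nth.
rewrite -count_predUI (leq_trans _ (leq_addr _ _))//.
by apply: sub_count => i /= ->; case: nth.
Qed.

Lemma open_sites_stalls c w : all c (open_sites w (stalls c w)).
Proof.
apply/allP => z /mapP[i]; rewrite mem_filter mem_iota /= => /andP[/andP[gi si] iw] ->.
rewrite -locE ?(ltnW iw)//; apply: good_at_open => //.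
by rewrite nth_mkseq in si.
Qed.

Lemma open_sites_stalls_bound c w z : z \in open_sites w (stalls c w) ->
  `|z.1| <= (size w)%:Z /\ `|z.2| <= (size w)%:Z.
Proof.
case/mapP => i; rewrite mem_filter mem_iota /= => /andP[_ iw] ->.
rewrite -locE ?(ltnW iw)//; have [] := @loc_bound c w i (ltnW iw); lia.
Qed.

(** * Enumeration of the patterns with few stalls *)

Fixpoint masks (n h : nat) : seq bitseq :=
  if n is n'.+1 then
    map (cons false) (masks n' h) ++
    (if h is h'.+1 then map (cons true) (masks n' h') else [::])
  else [:: [::]].

Lemma size_masks n h : (size (masks n h) <= n.+1 ^ h)%N.
Proof.
elim: n h => [|n IH] h; first by rewrite exp1n.
rewrite /= size_cat size_map; case: h => [|h].
  by rewrite addn0; apply: leq_trans (IH 0%N) _; rewrite !expn0.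
rewrite size_map; apply: (@leq_trans (n.+1 ^ h.+1 + n.+1 ^ h)).
  exact: leq_add.
have : (n.+1 ^ h <= n.+2 ^ h)%N by case: h => // h; rewrite leq_exp2r.
rewrite !expnS; nia.
Qed.

Lemma mem_masks n h b : size b = n -> (count id b <= h)%N -> b \in masks n h.
Proof.
elim: n h b => [|n IH] h [|x b] //= [sb]; rewrite mem_cat.
case: x => /= hb.
  case: h hb => // h hb; apply/orP; right; apply: map_f; exact: IH.
by apply/orP; left; apply: map_f; exact: IH.
Qed.

Lemma mem_masks_size n h b : b \in masks n h -> size b = n /\ (count id b <= h)%N.
Proof.
elim: n h b => [|n IH] h b /=; first by rewrite inE => /eqP ->.
rewrite mem_cat => /orP[/mapP[b' /IH[s k] ->]|] /=; first by rewrite s.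
by case: h => // h /mapP[b' /IH[s k] ->] /=; rewrite s add1n ltnS.
Qed.

(** * Law of the growing walk on a fixed initial graph *)

Section Law.
Variable R : realFieldType.

Definition left_blocked (c : int * int -> bool) (q : seq (int * int)) (x : int * int) : bool :=
  ~~ c x && (x + dvec Lt \notin q).

(** Closed form of [step_prob], with [q] the earlier positions: at a site already visited the right,
    up and down edges are open, and only the left edge has to be examined. *)
Definition transition c (q : seq (int * int)) (x y : int * int) : R :=
  if x \notin q then (y == x)%:R else
  let s := (y == x + dvec Rt)%:R + (y == x + dvec Up)%:R + (y == x + dvec Dn)%:R in
  if left_blocked c q x then s / 3 else (s + (y == x + dvec Lt)%:R) / 4.

Definition path_prob c (e : nat -> int * int) (s t : nat) : R :=
  \prod_(s <= i < t) transition c (mkseq e i) (e i) (e i.+1).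

Lemma transition_ge0 c q x y : 0 <= transition c q x y.
Proof.
by rewrite /transition; case: ifP => // _; case: ifP => _; rewrite divr_ge0// !addr_ge0.
Qed.

Lemma path_prob_ge0 c e s t : 0 <= path_prob c e s t.
Proof. by rewrite /path_prob prodr_ge0// => i _; exact: transition_ge0. Qed.

Lemma prefix_run c p w : prefix p (run c p w).
Proof.
elim: w p => [|a w IH] p /=; first exact: prefix_refl.
apply: prefix_trans (IH _); rewrite /move; case: ifP => _; first exact: prefix_refl.
case: ifP => _; rewrite ?prefix_rcons//.
by apply: prefix_trans (prefix_rcons _ _); rewrite prefix_rcons.
Qed.

Definition follows c (p : seq (int * int)) (e : nat -> int * int) (t : nat) w : bool :=
  (t < size (run c p w))%N && (take t.+1 (run c p w) == mkseq e t.+1).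

Lemma followsPn c p e t w k x : (k <= t)%N -> prefix (rcons (mkseq e k) x) p -> x != e k ->
  follows c p e t w = false.
Proof.
move=> kt pre xk; apply/negP => /andP[st /eqP E].
have /prefixP[s Es] := prefix_trans pre (prefix_run c p w).
have := congr1 (fun l => nth 0 l k) E.
rewrite /= nth_take// Es -cats1 -catA nth_cat size_mkseq ltnn subnn /=.
by move=> Ex; move: xk; rewrite Ex nth_mkseq ?eqxx// ltnS.
Qed.

Lemma mkseqS (e : nat -> int * int) k : mkseq e k.+1 = rcons (mkseq e k) (e k).
Proof. by rewrite /mkseq -[k.+1]addn1 iotaD map_cat cats1. Qed.

Lemma mem_mkseq_last (e : nat -> int * int) k : e k \in mkseq e k.+1.
Proof. by rewrite mkseqS mem_rcons inE eqxx. Qed.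

(** Induction on the word, from a time without pause. A blocked left step leaves the path unchanged,
    so the bound [f] satisfies [f = S / 4 + f / 4] with [S] the total for the other directions, that
    is [f = S / 3]: the remaining directions become uniform. Finite words may end before time [t],
    whence only an inequality. *)
Lemma avg_follows_le c e t n s : (s <= t)%N -> e s \in mkseq e s ->
  avg n (fun w => (follows c (mkseq e s.+1) e t w)%:R) <= path_prob c e s t.
Proof.
have small k p : avg k (fun w => (follows c p e t w)%:R) <= 1 :> R.
  by rewrite -[leRHS](avg_cst k); apply: avg_le => w _; rewrite lern1 leq_b1.
have ge0 k p : 0 <= avg k (fun w => (follows c p e t w)%:R) :> R.
  by apply: avg_ge0 => w _; rewrite ler0n.
have zero k p j x : (j <= t)%N -> prefix (rcons (mkseq e j) x) p -> x != e j ->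
    avg k (fun w => (follows c p e t w)%:R) = 0 :> R.
  move=> jt pre xj; rewrite -[RHS](avg_cst k); apply: eq_avg => w _.
  by rewrite (followsPn _ _ jt pre xj).
have path_probS j : (j < t)%N -> path_prob c e j t =
    transition c (mkseq e j) (e j) (e j.+1) * path_prob c e j.+1 t.
  by move=> jt; rewrite /path_prob big_ltn.
elim: n s => [|n IH] s st es.
  rewrite [leLHS](_ : _ = (follows c (mkseq e s.+1) e t [::])%:R)// /follows.
  rewrite [run _ _ _]/(mkseq e s.+1) size_map size_iota ltnS; move: st;
  rewrite leq_eqVlt => /orP[/eqP ->|st].
    by rewrite /path_prob big_geq// lern1 leq_b1.
  by rewrite leqNgt st path_prob_ge0.
move: st; rewrite leq_eqVlt => /orP[/eqP ->|st].
  by rewrite /path_prob big_geq.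
set p := mkseq e s.+1; have lp : last 0 p = e s by rewrite /p mkseqS last_rcons.
have step (a : dir) : ~~ blocked c p a ->
    avg n (fun w => (follows c p e t (a :: w))%:R) <=
      (e s.+1 == e s + dvec a)%:R * path_prob c e s.+1 t.
  move=> nb; rewrite /follows /= -/(follows _ _ _ _ _) /move (negbTE nb) lp.
  set z := e s + dvec a; case: eqP => [Ez|/eqP Ez]; last first.
    rewrite mul0r (zero _ _ s.+1 z)//; last by rewrite eq_sym.
    rewrite -/p; case: ifP => _; first exact: prefix_refl.
    exact: prefix_rcons.
  rewrite mul1r -Ez; case: ifP => [zp|/negbT zp].
    by rewrite /p -mkseqS; apply: IH.
  (* The new site is appended twice; unless [t] is reached, the second copy is the pause, of
     probability 1, and the induction resumes at [s.+2]. *)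
  move: st; rewrite leq_eqVlt => /orP[/eqP Et|st].
    by rewrite /path_prob [leRHS]big_geq ?Et//; exact: small.
  have [E2|E2] := eqVneq (e s.+1) (e s.+2); last first.
    rewrite (zero _ _ s.+2 (e s.+1))// ?path_prob_ge0//.
    by rewrite -mkseqS prefix_refl.
  have -> : rcons (rcons p (e s.+1)) (e s.+1) = mkseq e s.+3.
    by rewrite [RHS]mkseqS [in RHS]mkseqS -E2.
  rewrite path_probS// /transition zp -E2 eqxx mul1r.
  by apply: IH => //; rewrite -E2 mem_mkseq_last.
have Eb : blocked c p Lt = left_blocked c (mkseq e s) (e s).
  rewrite /blocked /left_blocked lp /= /p mkseqS mem_rcons inE negb_or.
  rewrite (_ : _ != e s)//; case: (e s) => x y.
  by rewrite xpair_eqE /= negb_and; apply/orP; left; apply/eqP; lia.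
have sR := step Rt isT; have sU := step Up isT; have sD := step Dn isT.
set Q := path_prob c e s.+1 t in sR sU sD.
have Es := path_probS s st; rewrite -/Q /transition es /= in Es.
rewrite avgS; case: ifP Es => lb Es.
  have : avg n (fun w => (follows c p e t (Lt :: w))%:R) <= path_prob c e s t.
    rewrite /follows /= -/(follows _ _ _ _ _) /move Eb lb.
    by apply: IH => //; exact: ltnW.
  by rewrite Es; lra.
have := step Lt; rewrite Eb lb => /(_ isT) sL; rewrite -/Q in sL.
by rewrite Es; lra.
Qed.

Lemma avg_follows_start c e t n :
  avg n (fun w => (follows c start e t w)%:R) <= (e 0%N == 0)%:R * path_prob c e 0 t.
Proof.
have zero k x : (k <= t)%N -> prefix (rcons (mkseq e k) x) start -> x != e k ->
    avg n (fun w => (follows c start e t w)%:R) = 0 :> R.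
  move=> jt pre xj; rewrite -[RHS](avg_cst n); apply: eq_avg => w _.
  by rewrite (followsPn _ _ jt pre xj).
have [e0|e0] := eqVneq (e 0%N) 0; last first.
  by rewrite (zero 0%N 0)//; rewrite ?mul0r// eq_sym.
rewrite mul1r; case: t zero => [|t] zero.
  rewrite /path_prob big_geq// -[leRHS](avg_cst n).
  by apply: avg_le => w _; rewrite lern1 leq_b1.
have [e1|e1] := eqVneq (e 1%N) 0; last first.
  rewrite (zero 1%N 0)//; rewrite ?path_prob_ge0// 1?eq_sym//.
  by rewrite /= e0.
rewrite /path_prob big_ltn// /transition /= e0 e1 eqxx mul1r.
have -> : start = mkseq e 2 by rewrite /start /mkseq /= e0 e1.
by apply: avg_follows_le; rewrite // /mkseq /= e0 e1.
Qed.

End Law.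

(** * Words on which the walk leaves the origin *)

Definition avoids (c : int * int -> bool) (w : seq dir) (t0 t1 : nat) : bool :=
  (t1 <= size (run c start w))%N &&
  all (fun t => nth 0 (run c start w) t != 0) (iota t0 (t1 - t0)).

(** Only a left step can leave the path unchanged. *)
Lemma size_run_ge c p w : (size p + unlefts w <= size (run c p w))%N.
Proof.
elim: w p => [|a w IH] p /=; first by rewrite addn0.
apply: leq_trans (IH _); rewrite /unlefts /= addnA leq_add2r /move /blocked.
by case: (is_left a) => /=; do ?(case: ifP => _); rewrite ?size_rcons; lia.
Qed.

Lemma size_run_le c p w : (size (run c p w) <= size p + (size w).*2)%N.
Proof.
elim: w p => [|a w IH] p /=; first by rewrite addn0.
apply: leq_trans (IH _) _; rewrite doubleS !addnS -!addSn leq_add2r /move.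
by case: ifP => _; [lia|case: ifP => _; rewrite !size_rcons; lia].
Qed.

Lemma nth_run_loc c w n t : (n <= size w)%N ->
  (size (run c start (take n w)) <= t < size (run c start w))%N ->
  exists2 i, (n <= i <= size w)%N & nth 0 (run c start w) t = loc c w i.
Proof.
move=> nw; suff H i : (n <= i <= size w)%N ->
    (size (run c start (take n w)) <= t < size (run c start (take i w)))%N ->
    exists2 i, (n <= i <= size w)%N & nth 0 (run c start w) t = loc c w i.
  by have := H (size w); rewrite nw leqnn take_size => /(_ isT).
elim: i => [|i IH] /andP[ni iw] /andP[t1 t2].
  by move: t1 t2; rewrite (_ : n = 0%N) ?take0; [rewrite leqNgt => /negbTE -> | lia].
have [ti|ti] := ltnP t (size (run c start (take i w))).
  have [{}ni|ni'] := leqP n i; first by apply: IH; rewrite ?ni ?t1//; lia.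
  by move: t1 t2; rewrite (_ : n = i.+1); [rewrite leqNgt => /negbTE -> | lia].
exists i.+1; first by rewrite ni iw.
have /prefixP[s ->] : prefix (run c start (take i.+1 w)) (run c start w).
  by rewrite -{2}(cat_take_drop i.+1 w) /run foldl_cat prefix_run.
rewrite nth_cat t2 /loc; move: ti t2; rewrite run_takeS// move_last /move.
case: ifP => [_|_]; first by rewrite leqNgt => /negbTE ->.
set r := run c start (take i w).
case: ifP => _ ti; rewrite !size_rcons => t2.
  by rewrite nth_rcons (_ : t = size r) ?ltnn ?eqxx//; lia.
have [->|->] : t = size r \/ t = (size r).+1 by lia.
  by rewrite !nth_rcons size_rcons ltnSn ltnn eqxx.
by rewrite nth_rcons size_rcons ltnn eqxx.
Qed.

(** The first [n] directions take fewer than [2 n + 2] time units. Afterwards the shift is at least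
    [H], while the simple random walk stays to the right of [- H], so the abscissa is positive. *)
Lemma avoids_stalls c w n t0 t1 (H : nat) : (n <= size w)%N -> (n.*2.+2 <= t0)%N ->
  (t1 <= unlefts w)%N -> ~~ goes_below H%:Z 0 w ->
  (H <= count id (stalls c (take n w)))%N -> avoids c w t0 t1.
Proof.
move=> nw nt0 t1w below stH; have st1 : (t1 <= size (run c start w))%N.
  by apply: leq_trans (size_run_ge c start w); rewrite (leq_trans t1w) ?leq_addl.
rewrite /avoids st1; apply/allP => t; rewrite mem_iota => /andP[t0t tt1].
have [|i /andP[ni iw] ->] := @nth_run_loc c w n t nw.
  apply/andP; split; last by lia.
  apply: leq_trans t0t; apply: leq_trans nt0; apply: leq_trans (size_run_le _ _ _) _.
  by rewrite size_take_min (minn_idPl nw) /= -doubleS.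
rewrite locE// /shifted; apply/negP => /eqP[Ex _].
have := goes_belowPn i below; rewrite add0r /X; move: Ex => /= Ex.
have : (H <= count id (take i (stalls c w)))%N.
  apply: leq_trans stH _.
  have -> : stalls c (take n w) = take n (stalls c w).
    have sn : size (take n w) = n by rewrite size_take_min; apply/minn_idPl.
    rewrite /stalls sn /mkseq -map_take take_iota (minn_idPl nw).
    apply/eq_in_map => k; rewrite mem_iota /= add0n => kn.
    by rewrite /stall take_takel ?(ltnW kn)// nth_take.
  by rewrite -(subnKC ni) takeD count_cat leq_addr.
by lia.
Qed.

(* The scale is [n = m ^ (4 * q)], so that [n^(1/2)] and [n^(3/4)] are powers of
   [m]. The origin is avoided between the times [2 n + 2] and [visit_end m q],
   which is where the next window starts when [m] is doubled. *)
Definition visit_end (m q : nat) : nat := (2 ^ (4 * q).+1 * m ^ (4 * q)).+2.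

(** With [n = m ^ (4 * q)]: the path lasts until the end of the window, the abscissa stays above
    [- m n^(1/2)], and there are at least [n^(3/4) / (2 m^2)] good steps by time [n]. *)
Definition usual (m q : nat) (w : seq dir) : bool :=
  [&& (visit_end m q <= unlefts w)%N,
      ~~ goes_below (m ^ (2 * q).+1)%:Z 0 w &
      (m ^ (2 * q - 1) * m ^ (q - 1) <= 2 * goods (take (m ^ (4 * q)) w))%N].

Section Usual.
Variable R : realFieldType.

(** Each of the three conditions fails with probability of order at most [1 / m], by
    [avg_few_unlefts], [avg_goes_below] and [avg_few_goods] respectively. *)
Lemma avg_unusual m q : (0 < m)%N -> (0 < q)%N ->
  m%:R * avg (2 * visit_end m q) (fun w => (~~ usual m q w)%:R)
    <= 3 + (2 ^ (4 * q).+2)%:R + 4 ^+ 11 :> R.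
Proof.
move=> m0 q0; set t1 := visit_end m q; set L := (2 * t1)%N; set n := (m ^ (4 * q))%N.
set H := (m ^ (2 * q).+1)%N.
have mR : 0 < m%:R :> R by rewrite ltr0n.
have n0 : (0 < n)%N by rewrite expn_gt0 m0.
have mn : (m <= n)%N by rewrite -{1}[m]expn1 leq_pexp2l// muln_gt0.
have nt1 : (n.*2 <= t1)%N.
  rewrite /t1 /visit_end -/n -muln2 mulnC.
  have : (2 <= 2 ^ (4 * q).+1)%N by rewrite expnS leq_pmulr ?expn_gt0.
  nia.
have t1n : (t1 <= 2 ^ (4 * q).+2 * n)%N.
  rewrite /t1 /visit_end -/n [(2 ^ (4 * q).+2)%N]expnS -mulnA; set z := (2 ^ _ * n)%N.
  have : (2 <= z)%N by rewrite /z expnS -mulnA leq_pmulr// muln_gt0 n0 expn_gt0.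
  lia.
have a1 : m%:R * avg L (fun w => (2 * unlefts w < L)%N%:R) <= 3 :> R.
  apply: le_trans (avg_few_unlefts R L); apply: ler_wpM2r; first exact: avg_ge0.
  by rewrite ler_nat /L; lia.
have a2 : m%:R * avg L (fun w => (goes_below H%:Z 0 w)%:R) <= (2 ^ (4 * q).+2)%:R :> R.
  have H0 : 0 < H%:Z by rewrite ltz_nat expn_gt0 m0.
  have := avg_goes_below R L 0 H0.
  set p := avg _ _; have p0 : 0 <= p by exact: avg_ge0.
  have -> : 0%:~R ^+ 2 + L%:R / 2 = t1%:R :> R by rewrite /L natrM; lra.
  rewrite -pmulrn.
  have -> : H%:R ^+ 2 = m%:R * m%:R * n%:R :> R.
    by rewrite -!natrM -natrX /H /n -expnM -mulnA -!expnS; congr (m ^ _)%:R; lia.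
  move=> h; have nR : 0 < n%:R :> R by rewrite ltr0n.
  have : p * (m%:R * m%:R) * n%:R <= (2 ^ (4 * q).+2)%:R * n%:R.
    rewrite -mulrA; apply: le_trans h _; by rewrite -natrM ler_nat.
  rewrite ler_pM2r//; apply: le_trans; rewrite mulrC ler_wpM2l// ler_peMl//.
  by rewrite ler1n.
have a3 : m%:R * avg L (fun w => (2 * goods (take n w) < m ^ (2 * q - 1) * m ^ (q - 1))%N%:R)
    <= 4 ^+ 11 :> R.
  have -> : L = (n + (L - n))%N by rewrite subnKC// /L; lia.
  rewrite (avg_take n _ (fun w => (2 * goods w < m ^ (2 * q - 1) * m ^ (q - 1))%N%:R)).
  apply: le_trans (avg_few_goods R m0 q0); rewrite ler_wpM2l//.
  apply: avg_le => w _; rewrite ler_nat.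
  case: ltnP => // h; rewrite lt0b; apply: leq_ltn_trans h.
  by rewrite leq_mul2l sum_new_row_goods_le orbT.
apply: le_trans (lerD (lerD a1 a2) a3); rewrite -!mulrDr ler_wpM2l// -!avgD.
apply: avg_le => w _; rewrite -!natrD ler_nat /usual.
rewrite -/n -/H -/t1 /L ltn_mul2l /= ltnNge [(2 * _ < _)%N]ltnNge.
by case: (t1 <= _)%N; case: goes_below; case: (_ * _ <= _)%N.
Qed.

End Usual.

Lemma unusual_stalls m q c w : size w = (2 * visit_end m q)%N -> (0 < m)%N ->
  usual m q w -> ~~ avoids c w (m ^ (4 * q)).*2.+2 (visit_end m q) ->
  (count id (stalls c (take (m ^ (4 * q)) w)) <= m ^ (2 * q).+1)%N.
Proof.
move=> sw m0 /and3P[h1 h2 _]; apply: contraNT; rewrite -ltnNge => h3.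
apply: (avoids_stalls _ _ h1 h2 (ltnW h3)) => //.
rewrite sw /visit_end; set n := (m ^ _)%N.
by have : (0 < 2 ^ (4 * q).+1)%N by [rewrite expn_gt0]; nia.
Qed.

(** There are at least [m / 2] times [m ^ (3 * q - 3)] good steps. As [q >= 4], the stalls number at
    most [m ^ (3 * q - 3)], and [m >= 4] leaves at least as many good steps without stall. *)
Lemma size_open_sites_usual m q w b : (3 < m)%N -> (3 < q)%N ->
  size w = (2 * visit_end m q)%N -> usual m q w ->
  b \in masks (m ^ (4 * q)) (m ^ (2 * q).+1) ->
  (m ^ (3 * q - 3) <= size (open_sites (take (m ^ (4 * q)) w) b))%N.
Proof.
move=> m3 q3 sw /and3P[_ _ hg] /mem_masks_size[sb cb].
have st : size (take (m ^ (4 * q)) w) = (m ^ (4 * q))%N.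
  rewrite size_take_min; apply/minn_idPl; rewrite sw /visit_end; set n := (m ^ _)%N.
  by have : (0 < 2 ^ (4 * q).+1)%N by [rewrite expn_gt0]; nia.
have := @size_open_sites (take (m ^ (4 * q)) w) b; rewrite st => /(_ sb).
apply: leq_trans; move: hg; set g := goods _.
have -> : (m ^ (2 * q - 1) * m ^ (q - 1) = m * m ^ (3 * q - 3))%N.
  by rewrite -expnD -expnS; congr (m ^ _)%N; lia.
have : (m ^ (2 * q).+1 <= m ^ (3 * q - 3))%N by rewrite leq_pexp2l//; lia.
move: cb; set x := (m ^ (2 * q).+1)%N; set z := (m ^ (3 * q - 3))%N; set k := count _ _.
nia.
Qed.

(** * Transition probabilities on the growing graph *)

Definition left_open (G : subgraph) (x : site) : bool :=
  `[< edges G (x + dvec Lt, false) >].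

Lemma mem_mkseqP (e : nat -> site) t z :
  reflect (exists2 s, (s < t)%N & e s = z) (z \in mkseq e t).
Proof.
apply: (iffP mapP) => -[s]; rewrite ?mem_iota /= ?add0n => st h; exists s => //.
by rewrite mem_iota.
Qed.

Lemma growing_edges (G0 : subgraph) e t a : edges (growing G0 e t) a <->
  edges G0 a \/ exists2 s, (s < t)%N &
    [\/ a = (e s, false), a = (e s, true) | a = (e s - e2, true)].
Proof.
elim: t => [|t IH] /=.
  by split=> [|[//|[s]]]; [left | rewrite ltn0].
have sub s : (s < t)%N -> (s < t.+1)%N by move=> st; rewrite ltnS ltnW.
case: ifP => ft /=.
  split.
  - case=> [/IH[|[s st h]]|h]; [by left|by right; exists s => //; exact: sub|].
    by right; exists t => //; case: h => [[->|->]|->]; [apply: Or31|apply: Or32|apply: Or33].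
  - case=> [h|[s]]; first by left; apply/IH; left.
    rewrite ltnS leq_eqVlt => /orP[/eqP ->|st h]; last by left; apply/IH; right; exists s.
    by case=> ->; right; [left; left|left; right|right].
rewrite IH; split=> [] [|[s st h]]; [by left|by right; exists s => //; exact: sub|by left|].
right; move: st h; rewrite ltnS leq_eqVlt => /orP[/eqP ->|st h]; last by exists s.
move/negbT: ft; rewrite negbK => /mem_mkseqP[s' s't <-] h.
by exists s'.
Qed.

(** The left edge of [x] is the right edge of its left neighbor, so only a visit to that neighbor
    can open it. *)
Lemma left_growing G0 e t x : edges (growing G0 e t) (x + dvec Lt, false) <->
  left_open G0 x || (x + dvec Lt \in mkseq e t).
Proof.
rewrite growing_edges; split.
- case=> [h|[s st]]; first by apply/orP; left; apply/asboolP.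
  by case=> // -[h]; apply/orP; right; apply/mem_mkseqP; exists s.
- case/orP => [/asboolP h|/mem_mkseqP[s st <-]]; first by left.
  by right; exists s => //; apply: Or31.
Qed.

Lemma adj_growing G0 e t y : e t \in mkseq e t ->
  let x := e t in
  adj (growing G0 e t) x y <->
  [\/ y = x + dvec Rt, y = x + dvec Up, y = x + dvec Dn |
      y = x + dvec Lt /\ ~~ left_blocked (left_open G0) (mkseq e t) x].
Proof.
move=> /mem_mkseqP[s st es] x.
have E1 (z : site) : z + e1 = z + dvec Rt by [].
have E2 (z : site) : z + e2 = z + dvec Up by [].
have N1 (z : site) : z + dvec Rt + dvec Lt = z by rewrite -addrA (_ : dvec _ + dvec _ = 0) ?addr0.
have N2 (z : site) : z + dvec Up + dvec Dn = z by rewrite -addrA (_ : dvec _ + dvec _ = 0) ?addr0.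
have N3 (z : site) : z + dvec Lt + dvec Rt = z by rewrite -addrA (_ : dvec _ + dvec _ = 0) ?addr0.
have N4 (z : site) : z + dvec Dn + dvec Up = z by rewrite -addrA (_ : dvec _ + dvec _ = 0) ?addr0.
have D (z : site) : z - e2 = z + dvec Dn by [].
have open b : [\/ b = (x, false), b = (x, true) | b = (x - e2, true)] ->
    edges (growing G0 e t) b.
  by move=> h; apply/growing_edges; right; exists s => //; rewrite es.
split.
- case=> -[v b] ab; rewrite /src /tgt /=.
  case=> -[xv yv].
    rewrite -xv in yv; case: b yv {ab} => ->; [by apply: Or42|by apply: Or41].
  rewrite yv; case: b xv ab => /= ->; first by move=> _; apply: Or43; rewrite E2 N2.
  move=> ab; apply: Or44; rewrite E1 N1; split=> //.
  rewrite /left_blocked negb_and !negbK; apply/left_growing.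
  by rewrite N1.
- case=> [->|->|->|[-> h]].
  + by exists (x, false); [apply: open; apply: Or31|left].
  + by exists (x, true); [apply: open; apply: Or32|left].
  + exists (x - e2, true); [by apply: open; apply: Or33|right].
    by rewrite /src /tgt /= D E2 N4.
  + exists (x + dvec Lt, false); last by right; rewrite /src /tgt /= E1 N3.
    by apply/left_growing; move: h; rewrite /left_blocked negb_and !negbK.
Qed.

Lemma dvec_inj (x : site) a b : x + dvec a = x + dvec b -> a = b.
Proof. by move/addrI; case: a; case: b. Qed.

Lemma card_fset_set_seq (T : choiceType) (s : seq T) (A : set T) : uniq s ->
  (forall y, A y <-> y \in s) -> #|` fset_set A| = size s.
Proof.
move=> us As; have -> : A = [set` [fset z in s]%fset].
  by apply/seteqP; split=> z /=; rewrite inE => /As.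
by rewrite set_fsetK card_fseq undup_id.
Qed.

Lemma step_probE (R : realType) G0 e t y :
  step_prob R G0 e t y = transition R (left_open G0) (mkseq e t) (e t) y.
Proof.
rewrite /step_prob /transition /first_visit; case: ifPn => // /negPn et.
have A z := adj_growing G0 z et; cbv zeta in A; set x := e t in A *.
have neq a b : a <> b -> (x + dvec a == x + dvec b) = false.
  by move=> ab; apply/eqP => /dvec_inj.
case: (boolP (left_blocked (left_open G0) (mkseq e t) x)) => lb.
  have -> : #|` fset_set (nbrs (growing G0 e t) x)| = 3.
    rewrite (@card_fset_set_seq _ [:: x + dvec Rt; x + dvec Up; x + dvec Dn])//.
      by rewrite !cons_uniq !inE !neq.
    move=> z; rewrite /nbrs /= A lb !inE; split.
      by case=> [->|->|->|[]//]; rewrite eqxx ?orbT.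
    by case/or3P => /eqP ->; [apply: Or41|apply: Or42|apply: Or43].
  case: ifPn => [/asboolP/A|nA].
    by rewrite lb => -[->|->|->|[]//]; rewrite eqxx !neq//= ?addr0 ?add0r mul1r.
  have nay a : a <> Lt -> y == x + dvec a = false.
    move=> al; apply/eqP => E; move/asboolP: nA; apply; apply/A.
    by case: a al E => // _ ->; [apply: Or41|apply: Or42|apply: Or43].
  by rewrite !nay// !addr0 mul0r.
have -> : #|` fset_set (nbrs (growing G0 e t) x)| = 4.
  rewrite (@card_fset_set_seq _ [:: x + dvec Rt; x + dvec Up; x + dvec Dn; x + dvec Lt])//.
    by rewrite !cons_uniq !inE !neq.
  move=> z; rewrite /nbrs /= A lb !inE; split.
    by case=> [->|->|->|[->]]; rewrite eqxx ?orbT.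
  by case/or4P => /eqP ->; [apply: Or41|apply: Or42|apply: Or43|apply: Or44].
case: ifPn => [/asboolP/A|nA].
  by rewrite lb => -[->|->|->|[-> _]]; rewrite eqxx !neq//= ?addr0 ?add0r mul1r.
have nay a : y == x + dvec a = false.
  apply/eqP => E; move/asboolP: nA; apply; apply/A; rewrite lb.
  by case: a E => ->; [apply: Or41|apply: Or42|apply: Or44|apply: Or43].
by rewrite !nay// !addr0 mul0r.
Qed.

(** * Law of the growing walk *)

Section RealProbability.
Variables (d : measure_display) (T : measurableType d) (R : realType).
Variable P : probability T R.

Definition Pr (A : set T) : R := fine (P A).

Lemma PrE A : measurable A -> P A = (Pr A)%:E.
Proof. by move=> mA; rewrite /Pr fineK// fin_num_measure. Qed.

Lemma Pr_ge0 A : 0 <= Pr A.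
Proof. by rewrite /Pr fine_ge0. Qed.

Lemma Pr_set0 : Pr set0 = 0.
Proof. by rewrite /Pr measure0. Qed.

Lemma Pr_setT : Pr setT = 1.
Proof. by rewrite /Pr probability_setT. Qed.

Lemma PrU A B : measurable A -> measurable B -> A `&` B = set0 ->
  Pr (A `|` B) = Pr A + Pr B.
Proof.
move=> mA mB AB; rewrite /Pr measureU// fineD// fin_num_measure//.
Qed.

Lemma Pr_split A B : measurable A -> measurable B ->
  Pr A = Pr (A `&` B) + Pr (A `&` ~` B).
Proof.
move=> mA mB; rewrite -PrU.
- by rewrite -setIUr setUv setIT.
- exact: measurableI.
- by apply: measurableI => //; exact: measurableC.
- by rewrite setIACA setICr setI0.
Qed.

Lemma Pr_le A B : measurable A -> measurable B -> A `<=` B -> Pr A <= Pr B.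
Proof.
move=> mA mB AB; rewrite (Pr_split mB mA) (_ : B `&` A = A); last exact/setIidPr.
by rewrite lerDl Pr_ge0.
Qed.

Lemma Pr_le1 A : measurable A -> Pr A <= 1.
Proof. by move=> mA; rewrite -Pr_setT Pr_le. Qed.

Lemma Pr_bigcup_le (I : eqType) (s : seq I) (B : I -> set T) A :
  (forall i, measurable (B i)) -> measurable A ->
  (forall w, A w -> exists2 i, i \in s & B i w) ->
  Pr A <= \sum_(i <- s) Pr (B i).
Proof.
move=> mB; elim: s A => [|i s IH] A mA HA.
  rewrite big_nil (_ : A = set0) ?Pr_set0//.
  by apply/seteqP; split=> // w /HA[].
rewrite big_cons (Pr_split mA (mB i)) lerD//.
  by apply: Pr_le => //; exact: measurableI.
apply: IH; first by apply: measurableI => //; exact: measurableC.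
move=> w [/HA[j]]; rewrite inE => /orP[/eqP ->//|js Bj _].
by exists j.
Qed.

Lemma sum_Pr_le (I : eqType) (s : seq I) (f : T -> I) A : uniq s ->
  (forall i, measurable (A `&` [set w | f w = i])) -> measurable A ->
  \sum_(i <- s) Pr (A `&` [set w | f w = i]) <= Pr A.
Proof.
elim: s A => [|i s IH] A /=; first by rewrite big_nil Pr_ge0.
move=> /andP[is_ us] mf mA; rewrite big_cons.
have mB := mf i; set B := A `&` _ in mB *.
have mAB : measurable (A `&` ~` B) by apply: measurableI => //; exact: measurableC.
have E j : j != i -> A `&` ~` B `&` [set w | f w = j] = A `&` [set w | f w = j].
  move=> ji; apply/seteqP; split=> w /=; first by case=> -[].
  by case=> Aw fw; split=> //; split=> //; case=> _ /= fi; move: ji; rewrite -fw fi eqxx.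
rewrite (Pr_split mA mB) (_ : A `&` B = B); last first.
  by apply/seteqP; split=> w; [case|move=> Bw; split=> //; case: Bw].
rewrite lerD2l; apply: le_trans (IH _ us _ mAB); last first.
  move=> j; have [->|/E -> //] := eqVneq j i.
  rewrite (_ : _ `&` _ = set0)//.
  by apply/seteqP; split=> // w [[Aw nB] fw]; apply: nB.
rewrite big_seq [leRHS]big_seq; apply: ler_sum => j js.
by rewrite E//; apply: contraNneq is_ => <-.
Qed.

End RealProbability.

Section Law.
Variables (d : measure_display) (T : measurableType d) (R : realType).
Variable P : probability T R.
Variables (D0 : T -> subgraph) (E : nat -> T -> site).
Hypothesis walk : growing_walk P D0 E.
Local Notation Pr := (Pr P).

Lemma sigma_pastI t A B : <<s past D0 E t >> A -> <<s past D0 E t >> B ->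
  <<s past D0 E t >> (A `&` B).
Proof.
move=> hA hB; rewrite -[A `&` B]setCK setCI; apply: sigma_algebraC.
have := @sigma_algebra_bigcup _ setT (past D0 E t)
  (fun n => if n is 0%N then ~` A else ~` B).
rewrite (_ : \bigcup_i _ = ~` A `|` ~` B).
  by apply=> -[|n]; exact: sigma_algebraC.
apply/seteqP; split=> w; first by case=> -[|n] _; [left|right].
by case=> h; [exists 0%N|exists 1%N].
Qed.

Lemma sigma_past_measurable t A : <<s past D0 E t >> A -> measurable A.
Proof.
apply: smallest_sub; first exact: sigma_algebra_measurable.
move=> B [[[x ->]|[a ->]]|[s [x [_ ->]]]].
- exact: (measurable_verts walk).
- exact: (measurable_edges walk).
- exact: (measurable_walk walk).
Qed.

(** Stands in for the events of the initial graph: such an event may be intersected with an event of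
    the past at any time before [walk_step] is applied. *)
Definition initial (A : set T) : Prop := forall t, <<s past D0 E t >> A.

Lemma initialT : initial setT.
Proof.
move=> t; have := sigma_algebraC (@sigma_algebra0 _ setT (past D0 E t)).
by rewrite setC0.
Qed.

Lemma initialI A B : initial A -> initial B -> initial (A `&` B).
Proof. by move=> hA hB t; exact: sigma_pastI. Qed.

Lemma initialC A : initial A -> initial (~` A).
Proof. by move=> hA t; exact: sigma_algebraC. Qed.

Lemma initial_measurable A : initial A -> measurable A.
Proof. by move=> /(_ 0%N)/sigma_past_measurable. Qed.

Definition left_set (x : site) : set T := [set w | left_open (D0 w) x].

Lemma left_setE x : left_set x = [set w | edges (D0 w) (x + dvec Lt, false)].
Proof. by apply/seteqP; split=> w h; exact/asboolP. Qed.

Lemma initial_left x : initial (left_set x).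
Proof.
move=> t; rewrite left_setE; apply: sub_sigma_algebra; left; right.
by exists (x + dvec Lt, false).
Qed.

(** Induction on [l]: the event is split according to the left edge of one site, whose value is then
    frozen in [Q]. *)
Lemma measurable_left_dep (l : seq site) (Q : (site -> bool) -> bool) :
  (forall c c', {in l, c =1 c'} -> Q c = Q c') ->
  measurable [set w | Q (left_open (D0 w))].
Proof.
elim: l Q => [|x l IH] Q HQ.
  have [h|h] := boolP (Q (fun=> true)).
    rewrite (_ : [set _ | _] = setT)//; apply/seteqP; split=> // w _ /=.
    by rewrite (HQ _ (fun=> true)).
  rewrite (_ : [set _ | _] = set0)//; apply/seteqP; split=> // w /=.
  by rewrite (HQ _ (fun=> true)) ?(negbTE h).
pose up b (c : site -> bool) z := if z == x then b else c z.
have mQ b : measurable [set w | Q (up b (left_open (D0 w)))].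
  apply: (IH (Q \o up b)) => c c' cc' /=; apply: HQ => z; rewrite inE /up.
  by case: eqP => //= _ zl; exact: cc'.
have mx := initial_measurable (initial_left x).
rewrite (_ : [set _ | _] = (left_set x `&` [set w | Q (up true (left_open (D0 w)))]) `|`
  (~` left_set x `&` [set w | Q (up false (left_open (D0 w)))])).
  by apply: measurableU; apply: measurableI => //; exact: measurableC.
have upE w b : left_open (D0 w) x = b -> Q (up b (left_open (D0 w))) = Q (left_open (D0 w)).
  by move=> xb; apply: HQ => z _; rewrite /up; case: eqP => [->|].
apply/seteqP; split=> w /=.
  move=> Qw; have [h|h] := boolP (left_open (D0 w) x).
    by left; split=> //; rewrite upE.
  by right; split; [exact/negP|rewrite upE//; exact: negbTE].
case=> -[xw]; first by rewrite upE.
by rewrite upE//; exact/negbTE/negP.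
Qed.

Definition history t (e : nat -> site) : set T := [set w | forall s, (s <= t)%N -> E s w = e s].

Lemma historyS t e : history t.+1 e = history t e `&` [set w | E t.+1 w = e t.+1].
Proof.
apply/seteqP; split=> w /=.
  by move=> h; split; [move=> s st; apply: h; exact: leqW|exact: h].
by case=> h h1 s; rewrite leq_eqVlt => /orP[/eqP ->//|]; rewrite ltnS; exact: h.
Qed.

Lemma sigma_past_walk s t x : (s <= t)%N -> <<s past D0 E t >> [set w | E s w = x].
Proof. by move=> st; apply: sub_sigma_algebra; right; exists s, x. Qed.

Lemma sigma_past_history s t e : (s <= t)%N -> <<s past D0 E t >> (history s e).
Proof.
elim: s => [|s IH] st.
  rewrite (_ : history _ _ = [set w | E 0%N w = e 0%N]); first exact: sigma_past_walk.
  by apply/seteqP; split=> w /=; [exact|move=> h [|]].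
by rewrite historyS; apply: sigma_pastI; [apply: IH; exact: ltnW|exact: sigma_past_walk].
Qed.

Lemma transition_ext (c c' : site -> bool) q x y : c x = c' x ->
  transition R c q x y = transition R c' q x y.
Proof. by rewrite /transition /left_blocked => ->. Qed.

(** Chain rule: on [A] and a given history, the conditional law of the next position is constant, as
    it sees the initial graph only through the left edge of the current site. *)
Lemma Pr_history (A : set T) (c : site -> bool) (e : nat -> site) t : initial A ->
  (forall w s, A w -> (s < t)%N -> left_open (D0 w) (e s) = c (e s)) ->
  Pr (A `&` history t e) = Pr A * ((e 0%N == 0)%:R * path_prob R c e 0 t).
Proof.
move=> hA; elim: t => [|t IH] Hc.
  have -> : history 0 e = [set w | E 0%N w = e 0%N].
    by apply/seteqP; split=> w /=; [exact|move=> h [|]].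
  rewrite /path_prob big_geq// mulr1.
  have m0 x := measurable_walk walk 0 x.
  have mA := initial_measurable hA.
  have P0 : Pr [set w | E 0%N w = 0] = 1 by rewrite /Pr (walk_start walk).
  have Pc (B : set T) : measurable B -> B `<=` ~` [set w | E 0%N w = 0] -> Pr B = 0.
    move=> mB BC; apply/eqP; rewrite eq_le Pr_ge0 andbT.
    have := Pr_split P measurableT (m0 0); rewrite !setTI P0 Pr_setT => h.
    have -> : 0 = Pr (~` [set w | E 0%N w = 0]) by lra.
    by apply: Pr_le => //; exact: measurableC.
  case: eqP => [->|e0].
    rewrite mulr1 [RHS](Pr_split P mA (m0 0)) [X in _ + X]Pc ?addr0//.
      by apply: measurableI => //; exact: measurableC.
  rewrite mulr0 Pc//; first exact: measurableI.
  by move=> w [_ /= ->].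
rewrite historyS setIA.
have hB : <<s past D0 E t >> (A `&` history t e).
  by apply: sigma_pastI; [exact: hA|exact: sigma_past_history].
have mB := sigma_past_measurable hB.
rewrite /path_prob big_nat_recr//= -/(path_prob R c e 0 t).
rewrite [RHS](_ : _ = Pr A * ((e 0%N == 0)%:R * path_prob R c e 0 t) *
  transition R c (mkseq e t) (e t) (e t.+1)); last by rewrite !mulrA.
rewrite -IH; last by move=> w s Aw st; apply: Hc => //; exact: leqW.
rewrite {1}/Pr (walk_step walk _ hB).
rewrite (eq_integral (cst (transition R c (mkseq e t) (e t) (e t.+1))%:E)).
  by rewrite integral_cst// fineM// ?fin_num_measure//; exact: mulrC.
move=> w; rewrite inE => -[Aw Hw]; rewrite /= step_probE Hw//.
rewrite (transition_ext _ _ (Hc w t Aw _))//; congr (transition _ _ _ _ _)%:E.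
by apply/eq_in_map => s; rewrite mem_iota /= => st; rewrite Hw//; exact: ltnW.
Qed.

End Law.

(** * Domination by the uniform average over words *)

Fixpoint images (I : Type) (n : nat) (f : seq dir -> I) : seq I :=
  if n is n'.+1 then
    images n' (fun w => f (Rt :: w)) ++ images n' (fun w => f (Up :: w)) ++
    images n' (fun w => f (Lt :: w)) ++ images n' (fun w => f (Dn :: w))
  else [:: f [::]].

Lemma mem_images (I : eqType) n (f : seq dir -> I) r :
  reflect (exists2 w, size w = n & f w = r) (r \in images n f).
Proof.
apply: (iffP idP).
  elim: n f => [|n IH] f /=; first by rewrite inE => /eqP ->; exists [::].
  by rewrite !mem_cat => /or4P[] /IH[w <- <-];
    [exists (Rt :: w)|exists (Up :: w)|exists (Lt :: w)|exists (Dn :: w)].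
elim: n f => [|n IH] f [w sw fw]; first by rewrite -fw (size0nil sw) mem_head.
case: w sw fw => // a w [sw] fw; rewrite /= !mem_cat.
have H : r \in images n (fun w => f (a :: w)) by apply: IH; exists w.
by case: a {fw} H => ->; rewrite ?orbT.
Qed.

Definition box_sites (n : nat) : seq site :=
  let s := [seq k%:Z - n%:Z | k <- iota 0 n.*2.+1] in [seq (x, y) | x <- s, y <- s].

Lemma mem_box_sites n (z : site) : `|z.1| <= n%:Z -> `|z.2| <= n%:Z -> z \in box_sites n.
Proof.
case: z => x y /= xn yn.
have H (u : int) : `|u| <= n%:Z -> u \in [seq k%:Z - n%:Z | k <- iota 0 n.*2.+1].
  move=> un; apply/mapP; exists (absz (u + n%:Z)); first by rewrite mem_iota /=; lia.
  by lia.
by apply/allpairsP; exists (x, y); split => //; apply: H.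
Qed.

Lemma run_ext (c c' : site -> bool) w : {in box_sites (size w), c =1 c'} ->
  run c start w = run c' start w.
Proof.
move=> cc'; suff H i : (i <= size w)%N -> run c start (take i w) = run c' start (take i w).
  by have := H _ (leqnn _); rewrite take_size.
elim: i => [|i IH] iw; first by rewrite take0.
rewrite !run_takeS// -IH ?(ltnW iw)//; set p := run c start _.
rewrite /move /blocked cc'//; have [h1 h2] := loc_bound c (ltnW iw).
by apply: mem_box_sites; [move: h1|move: h2]; rewrite /loc -/p; lia.
Qed.

Lemma avoids_ext (c c' : site -> bool) w t0 t1 : {in box_sites (size w), c =1 c'} ->
  avoids c w t0 t1 = avoids c' w t0 t1.
Proof. by move=> cc'; rewrite /avoids (run_ext cc'). Qed.

Section Domination.
Variables (d : measure_display) (T : measurableType d) (R : realType).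
Variable P : probability T R.
Variables (D0 : T -> subgraph) (E : nat -> T -> site).
Hypothesis walk : growing_walk P D0 E.
Local Notation Pr := (Pr P).

Definition off_origin (t0 t1 : nat) : set T :=
  [set w | forall t, (t0 <= t < t1)%N -> E t w != 0].

Lemma measurable_off_origin t0 t1 : measurable (off_origin t0 t1).
Proof.
rewrite (_ : off_origin _ _ =
  \bigcap_(t in [set t | (t0 <= t < t1)%N]) ~` [set w | E t w = 0]).
  by apply: bigcap_measurableType => // t _; apply: measurableC; exact: (measurable_walk walk).
apply/seteqP; split=> w /= h t tt; first by apply/eqP; exact: h.
by apply/eqP; exact: h.
Qed.

Definition avoid_set (t0 t1 : nat) (u : seq dir) : set T :=
  [set w | avoids (left_open (D0 w)) u t0 t1].

Lemma measurable_avoid_set t0 t1 u : measurable (avoid_set t0 t1 u).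
Proof.
apply: (measurable_left_dep walk (l := box_sites (size u)) (Q := fun c => avoids c u t0 t1)).
by move=> c c' cc'; exact: avoids_ext.
Qed.

(** The words are grouped by the path [r] that they generate up to time [t1]. Distinct paths give
    disjoint events, and on [A] the walk follows [r] with at least the probability that a word
    generates [r]. *)
Lemma cylinder_avoids (A : set T) (c : site -> bool) L t0 t1 :
  initial D0 E A -> (t0 < t1)%N ->
  (forall w z, A w -> z \in box_sites L -> left_open (D0 w) z = c z) ->
  Pr A * avg L (fun u => (avoids c u t0 t1)%:R) <= Pr (A `&` off_origin t0 t1).
Proof.
move=> hA t01 Hc; have mA := initial_measurable walk hA.
have [t' Et] : exists t, t1 = t.+1 by case: t1 t01 => // t _; exists t.
pose f (w : T) := mkseq (E^~ w) t1.
pose ok (r : seq site) := (size r == t1) && all (fun t => nth 0 r t != 0) (iota t0 (t1 - t0)).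
pose es := undup [seq r <- images L (fun u => take t1 (run c start u)) | ok r].
have mB : measurable (A `&` off_origin t0 t1).
  by apply: measurableI => //; exact: measurable_off_origin.
have fE r : size r = t1 -> [set w | f w = r] = history E t' (nth 0 r).
  move=> sr; apply/seteqP; split=> w /=.
    by move=> fw s st; rewrite -fw nth_mkseq// Et.
  move=> Hw; apply: (@eq_from_nth _ 0); rewrite /f size_mkseq// => i it.
  by rewrite nth_mkseq// Hw// -ltnS -Et.
have mf r : measurable (A `&` off_origin t0 t1 `&` [set w | f w = r]).
  apply: measurableI => //; have [sr|sr] := eqVneq (size r) t1.
    by rewrite fE//; apply: (sigma_past_measurable walk (t := t')); exact: sigma_past_history.
  rewrite (_ : [set _ | _] = set0)//; apply/seteqP; split=> // w /= fw.
  by move: sr; rewrite -fw size_mkseq eqxx.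
apply: le_trans (sum_Pr_le P (undup_uniq _ : uniq es) mf mB).
have A0 : 0 <= Pr A by exact: Pr_ge0.
pose Q (r : seq site) u := follows c start (nth 0 r) t' u.
apply: (@le_trans _ _ (Pr A * \sum_(r <- es) avg L (fun u => (Q r u)%:R))).
  rewrite ler_wpM2l//; apply: avg_union_bound => u su /andP[t1u /allP Hu].
  have sr : size (take t1 (run c start u)) = t1 by rewrite size_takel.
  apply/hasP; exists (take t1 (run c start u)).
    rewrite mem_undup mem_filter; apply/andP; split; last by apply/mem_images; exists u.
    rewrite /ok sr eqxx; apply/allP => t tt; rewrite nth_take ?Hu//.
    by move: tt; rewrite mem_iota; lia.
  by rewrite /Q /follows -Et t1u andTb -[X in mkseq _ X]sr mkseq_nth.
rewrite mulr_sumr big_seq [leRHS]big_seq; apply: ler_sum => r.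
rewrite mem_undup mem_filter => /andP[/andP[/eqP sr /allP offr] /mem_images[u su ur]].
rewrite (_ : _ `&` _ = A `&` history E t' (nth 0 r)); last first.
  rewrite -fE//; apply/seteqP; split=> w; first by case=> -[].
  case=> Aw fw; split=> //; split=> // t tt.
  have -> : E t w = nth 0 r t by rewrite -fw nth_mkseq//; lia.
  by apply: offr; rewrite mem_iota; lia.
rewrite (@Pr_history _ _ _ _ _ _ walk A c)//.
  by rewrite ler_wpM2l// avg_follows_start.
move=> w s Aw st; apply: Hc => //; rewrite -ur nth_take; last by rewrite Et leqW.
have sr' : (s < size (run c start u))%N.
  have : (t1 <= size (run c start u))%N.
    by move: sr; rewrite -ur size_take_min; lia.
  by rewrite Et; apply: leq_ltn_trans; exact: ltnW.
have := mem_nth 0 sr'; rewrite -[X in run c start X](take_size u).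
case/(mem_run (leqnn _)) => k ku ->.
have [h1 h2] := loc_bound c ku.
by apply: mem_box_sites; rewrite -su; [apply: le_trans h1 _|apply: le_trans h2 _]; rewrite lez_nat.
Qed.

(** [cylinder_avoids] averaged over the initial graph. Words of length [L] only examine left edges
    at the sites of a box; the induction reveals them one at a time, [fixed] being the sites already
    treated, until [A] determines them all. *)
Lemma avg_avoid_set L t0 t1 : (t0 < t1)%N ->
  avg L (fun u => Pr (avoid_set t0 t1 u)) <= Pr (off_origin t0 t1).
Proof.
move=> t01; pose V := avoid_set t0 t1; pose S := off_origin t0 t1.
have mV u : measurable (V u) by exact: measurable_avoid_set.
have mS : measurable S by exact: measurable_off_origin.
suff H l fixed A c : initial D0 E A ->
    (forall w z, A w -> z \in fixed -> left_open (D0 w) z = c z) ->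
    {subset box_sites L <= l ++ fixed} ->
    avg L (fun u => Pr (A `&` V u)) <= Pr (A `&` S).
  have := H (box_sites L) [::] setT (fun=> true) (@initialT _ _ _ _).
  rewrite setTI (_ : (fun u => _) = fun u => Pr (V u)); last first.
    by apply/funext => u; rewrite setTI.
  by apply=> // z; rewrite cats0.
elim: l fixed A c => [|x l IH] fixed A c hA Hc sub.
  have Hc' w z : A w -> z \in box_sites L -> left_open (D0 w) z = c z.
    by move=> Aw /sub; exact: Hc.
  apply: le_trans (cylinder_avoids hA t01 Hc'); rewrite -avgZ.
  apply: avg_le => u su; rewrite /V /avoid_set.
  have E1 w : A w -> avoids (left_open (D0 w)) u t0 t1 = avoids c u t0 t1.
    by move=> Aw; apply: avoids_ext; rewrite su => z; exact: Hc'.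
  case: (boolP (avoids c u t0 t1)) => h.
    rewrite mulr1 (_ : _ `&` _ = A)//; apply/seteqP; split=> w; first by case.
    by move=> Aw; split=> //=; rewrite E1.
  rewrite mulr0 (_ : _ `&` _ = set0) ?Pr_set0//.
  by apply/seteqP; split=> // w [Aw /=]; rewrite E1// (negbTE h).
have mA := initial_measurable walk hA.
have hx : initial D0 E (left_set D0 x) by exact: initial_left.
 have mx := initial_measurable walk hx.
rewrite (_ : (fun u => _) = fun u =>
    Pr (A `&` left_set D0 x `&` V u) + Pr (A `&` ~` left_set D0 x `&` V u)).
  rewrite avgD (@Pr_split _ _ _ P (A `&` S) (left_set D0 x))//; last exact: measurableI.
  rewrite ![A `&` S `&` _]setIAC.
  have step (b : bool) B : initial D0 E B -> (forall w, B w -> left_open (D0 w) x = b) ->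
      avg L (fun u => Pr (A `&` B `&` V u)) <= Pr (A `&` B `&` S).
    move=> hB Bx; apply: (IH (x :: fixed) _ (fun z => if z == x then b else c z)).
    - exact: initialI.
    - move=> w z [Aw Bw]; rewrite inE; case: eqP => [-> _|_ /= zf]; first exact: Bx.
      exact: Hc.
    - by move=> z /sub; rewrite !mem_cat !inE => /orP[/orP[]|] ->; rewrite ?orbT.
  rewrite lerD//; [apply: (step true)|apply: (step false)] => //.
    exact: initialC.
  by move=> w /negP/negbTE.
apply/funext => u; rewrite (@Pr_split _ _ _ P (A `&` V u) (left_set D0 x))//.
  by rewrite ![A `&` V u `&` _]setIAC.
exact: measurableI.
Qed.

(** Unusual words contribute a term of order [1 / m]; for each usual word, only the initial graph is
    still random. *)
Lemma Pr_visit_le m q (eps : R) : (0 < m)%N -> (0 < q)%N -> 0 <= eps ->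
  let t0 := (m ^ (4 * q)).*2.+2 in
  (forall u, size u = (2 * visit_end m q)%N -> usual m q u ->
     Pr (~` avoid_set t0 (visit_end m q) u) <= eps) ->
  m%:R * Pr (~` off_origin t0 (visit_end m q))
    <= 3 + (2 ^ (4 * q).+2)%:R + 4 ^+ 11 + m%:R * eps.
Proof.
move=> m0 q0 eps0 t0 Hu; set t1 := visit_end m q in Hu *; set L := (2 * t1)%N in Hu *.
have t01 : (t0 < t1)%N.
  rewrite /t0 /t1 /visit_end -muln2 !ltnS mulnC; set n := (m ^ _)%N.
  have n0 : (0 < n)%N by rewrite expn_gt0 m0.
  rewrite ltn_pmul2r// expnS.
  have : (1 < 2 ^ (4 * q))%N by rewrite -{1}(expn0 2) ltn_exp2l// muln_gt0.
  lia.
have mS : measurable (off_origin t0 t1) by exact: measurable_off_origin.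
have PC A : measurable A -> Pr (~` A) = 1 - Pr A.
  by move=> mA; rewrite -(Pr_setT P) (Pr_split P measurableT mA) !setTI addrC addKr.
rewrite PC//; have h1 := avg_avoid_set L t01; have h2 := avg_unusual R m0 q0.
apply: (@le_trans _ _ (m%:R * (avg L (fun w => (~~ usual m q w)%:R) + eps))); last first.
  by rewrite mulrDr lerD2r.
rewrite ler_wpM2l// -[eps](avg_cst L) -avgD.
apply: (@le_trans _ _ (avg L (fun u => Pr (~` avoid_set t0 t1 u)))).
  rewrite (_ : (fun u => _) = fun u => 1 + (-1) * Pr (avoid_set t0 t1 u)).
    by rewrite avgD avgZ avg_cst; lra.
  by apply/funext => u; rewrite PC ?mulN1r//; exact: measurable_avoid_set.
apply: avg_le => u su; case: (boolP (usual m q u)) => hu /=.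
  by rewrite add0r Hu.
rewrite (@le_trans _ _ 1) ?lerDl//; apply: Pr_le1; apply: measurableC.
exact: measurable_avoid_set.
Qed.

End Domination.

(** * Transience *)

Section Transience.
Variables (d : measure_display) (T : measurableType d) (R : realType).
Variable P : probability T R.
Variables (D0 : T -> subgraph) (E : nat -> T -> site).
Hypothesis walk : growing_walk P D0 E.

(** Borel-Cantelli along [m = 2 ^ j]: a visit to the origin in the [j]-th window has probability of
    order at most [2 ^ - j], and the windows follow one another without gaps, so they cover all
    large times. *)
Lemma transient_ae q (C : R) (eps : nat -> R) j0 : (0 < q)%N ->
  (forall j, 0 <= eps j) ->
  (forall j u, (j0 <= j)%N -> size u = (2 * visit_end (2 ^ j) q)%N -> usual (2 ^ j) q u ->
     Pr P (~` avoid_set D0 ((2 ^ j) ^ (4 * q)).*2.+2 (visit_end (2 ^ j) q) u) <= eps j) ->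
  (forall j, (j0 <= j)%N -> (2 ^ j)%:R * eps j <= C) ->
  {ae P, forall w, transient (E^~ w)}.
Proof.
move=> q0 eps0 Heps HC.
pose t0 j := ((2 ^ j) ^ (4 * q)).*2.+2; pose t1 j := visit_end (2 ^ j) q.
have t1E j : t1 j = t0 j.+1.
  rewrite /t1 /t0 /visit_end -!expnM -muln2 -expnSr -expnD; congr (2 ^ _).+2; lia.
pose F j := ~` off_origin E (t0 (j0 + j)%N) (t1 (j0 + j)%N).
have mF j : measurable (F j) by apply: measurableC; exact: measurable_off_origin walk _ _.
set K : R := 3 + (2 ^ (4 * q).+2)%:R + 4 ^+ 11 + C.
have PF j : Pr P (F j) <= (2 * K) / (2 ^ j.+1)%:R.
  have m0 : (0 < 2 ^ (j0 + j))%N by rewrite expn_gt0.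
  have h1 := Pr_visit_le walk m0 q0 (eps0 (j0 + j)%N)
    (fun u su us => Heps _ u (leq_addr j j0) su us).
  have h2 := HC (j0 + j)%N (leq_addr j j0).
  rewrite ler_pdivlMr ?ltr0n ?expn_gt0// expnS natrM.
  have : (2 ^ j)%:R * Pr P (F j) <= (2 ^ (j0 + j))%:R * Pr P (F j).
    by rewrite ler_wpM2r ?Pr_ge0// ler_nat leq_pexp2l// leq_addl.
  have h3 : (2 ^ (j0 + j))%:R * Pr P (F j) <= K.
    by apply: le_trans h1 _; rewrite /K lerD2l.
  by lra.
have K0 : 0 <= 2 * K.
  have := PF 0%N; rewrite ler_pdivlMr// => h; apply: le_trans h.
  by rewrite mulr_ge0 ?Pr_ge0.
exists (lim_sup_set F); split.
- apply: bigcap_measurableType => n _; apply: bigcup_measurable => j _; exact: mF.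
- apply: lim_sup_set_cvg0 => //.
  apply: (@le_lt_trans _ _ (2 * K)%:E); last exact: ltry.
  apply: le_trans (epsilon_trick0 xpredT K0).
  apply: lee_nneseries => [j _ _|j _]; first exact: measure_ge0.
  by have := PF j; rewrite -lee_fin -(PrE P (mF j)).
move=> w /=; apply: contra_notP => nF.
have [N hN] : exists N, forall j, (N <= j)%N -> off_origin E (t0 (j0 + j)%N) (t1 (j0 + j)%N) w.
  apply: contra_notP nF => nN n _; apply: contra_notP nN => nj.
  by exists n => j nj'; apply: contra_notP nj => h; exists j.
apply: (@sub_finite_set _ _ `I_(t0 (j0 + N)%N)); last exact: finite_II.
move=> t /= Et; rewrite ltnNge; apply/negP => tN.
have le_t0 j : (j <= t0 j)%N.
  have := ltn_expl j (ltnSn 1); rewrite /t0; set m := (2 ^ j)%N => jm.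
  have : (m <= m ^ (4 * q))%N by rewrite -{1}[m]expn1 leq_pexp2l ?muln_gt0// expn_gt0.
  lia.
have ex : exists j, (t0 j <= t)%N by exists (j0 + N)%N.
have ub j : (t0 j <= t)%N -> (j <= t)%N by apply: leq_trans.
case: (ex_maxnP ex ub) => j tj maxj.
have jN := maxj _ tN.
have Nj : (N <= j - j0)%N by lia.
have := hN _ Nj t; rewrite subnKC; last by lia.
rewrite tj t1E Et eqxx /= ltnNge.
suff -> : ~~ (t0 j.+1 <= t)%N by move/(_ isT).
by apply/negP => /maxj; rewrite ltnn.
Qed.

End Transience.

(** * The two kinds of initial graph *)

(** On a usual word, failing to avoid the origin means few stalls, hence many good steps that went
    through edges of the initial graph. Both cases of the theorem contradict this, surely or with
    high probability. *)
Lemma unusual_open_sites (m q : nat) (c : site -> bool) (u : seq dir) :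
  (3 < m)%N -> (3 < q)%N -> size u = (2 * visit_end m q)%N -> usual m q u ->
  ~~ avoids c u (m ^ (4 * q)).*2.+2 (visit_end m q) ->
  let v := take (m ^ (4 * q)) u in
  let b := stalls c v in
  [/\ b \in masks (m ^ (4 * q)) (m ^ (2 * q).+1), all c (open_sites v b),
      (m ^ (3 * q - 3) <= size (open_sites v b))%N &
      forall z, z \in open_sites v b -> `|z.1| <= (m ^ (4 * q))%:Z /\ `|z.2| <= (m ^ (4 * q))%:Z].
Proof.
move=> m3 q3 su us na v b; have m0 : (0 < m)%N by exact: leq_trans m3.
have sv : size v = (m ^ (4 * q))%N.
  rewrite size_take_min; apply/minn_idPl; rewrite su /visit_end; set n := (m ^ _)%N.
  by have : (0 < 2 ^ (4 * q).+1)%N by [rewrite expn_gt0]; nia.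
have hb : b \in masks (m ^ (4 * q)) (m ^ (2 * q).+1).
  by apply: mem_masks; [rewrite size_mkseq|exact: (unusual_stalls su m0 us na)].
split=> //.
- exact: open_sites_stalls.
- exact: (size_open_sites_usual m3 q3 su us hb).
- by move=> z /open_sites_stalls_bound; rewrite sv.
Qed.

Lemma finite_box k : finite_set (box k).
Proof.
apply: (@sub_finite_set _ _ [set` box_sites k]); last exact: finite_seq.
by move=> z [h1 h2] /=; apply: mem_box_sites.
Qed.

Lemma size_left_open_le (G : subgraph) k (s : seq site) : uniq s -> all (left_open G) s ->
  (forall z, z \in s -> `|z.1| <= k%:Z /\ `|z.2| <= k%:Z) -> (size s <= sites_in_box G k)%N.
Proof.
move=> us /allP os bs; rewrite -(undup_id us) -(card_fseq s).
apply: fsubset_leq_card; apply/fsubsetP => z; rewrite inE => zs.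
rewrite in_fset_set; last exact: finite_setIr (finite_box k).
rewrite inE; split; last exact: bs.
have /asboolP/edges_verts[_] := os z zs.
rewrite /tgt /= -addrA (_ : dvec Lt + e1 = 0) ?addr0//.
Qed.

(** For [n = m ^ (4 * q)], the hypothesis on [q] gives [n^r <= m ^ (3 * q - 3)], the number of open
    sites to be contradicted. *)
Lemma sites_in_box_eventually (R : realType) (G : subgraph) (r : R) (q : nat) :
  r * (4 * q)%:R <= (3 * q - 3)%:R ->
  (k%:R `^ (- r) * (sites_in_box G k)%:R : R) @[k --> \oo] --> (0 : R) ->
  exists N, forall m, (0 < m)%N -> (N <= m ^ (4 * q))%N ->
    (sites_in_box G (m ^ (4 * q)) < m ^ (3 * q - 3))%N.
Proof.
move=> rq /cvgrPdist_lt/(_ 1 ltr01)[N _ HN]; exists N => m m0 Nm.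
have := HN _ Nm; rewrite /= sub0r normrN.
set n := (m ^ (4 * q))%N; set s := sites_in_box G n.
have m1 : 1 <= m%:R :> R by rewrite ler1n.
have n0 : 0 < n%:R :> R by rewrite ltr0n expn_gt0 m0.
rewrite ger0_norm ?mulr_ge0 ?powR_ge0// powRN mulrC ltr_pdivrMr ?powR_gt0// mul1r.
move=> h; rewrite -(ltr_nat R); apply: lt_le_trans h _.
rewrite /n !natrX -powR_mulrn// -powRrM -powR_mulrn//.
by rewrite ler_powR// mulrC.
Qed.

Lemma percolation_left_open (d : measure_display) (T : measurableType d) (R : realType)
    (P : probability T R) (p : R) (D0 : T -> subgraph) (s : seq site) :
  percolation P p D0 -> uniq s ->
  P [set w | all (left_open (D0 w)) s] = (p ^+ size s)%:E.
Proof.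
move=> perc us; pose f (z : site) : edge := (z + dvec Lt, false).
have finj : injective f by move=> x y /(congr1 fst)/addIr.
have us' : uniq (map f s) by rewrite map_inj_uniq.
have := percolation_indep perc [fset a in map f s]%fset.
rewrite (_ : \bigcap_(i in _) _ = [set w | all (left_open (D0 w)) s]).
  move=> ->; under eq_bigr do rewrite (percolation_edges perc).
  rewrite (perm_big _ (_ : perm_eq _ (map f s))) /=; last first.
    apply: uniq_perm => //; first exact: fset_uniq.
    by move=> a; rewrite inE.
  elim: (s) => [|z l IH]; first by rewrite big_nil expr0.
  by rewrite map_cons big_cons IH -EFinM -exprS.
apply/seteqP; split=> w /=.
  move=> h; apply/allP => z zs; apply/asboolP; apply: (h (f z)).
  by rewrite /= inE map_f.
by move=> /allP h a; rewrite /= inE => /mapP[z zs ->]; apply/asboolP; exact: h.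
Qed.

(** The exponents are [4 * q], [2 * q + 1] and [3 * q - 3] for [q = 6]. The number of patterns is at
    most [2 ^ (25 * m ^ 14)], which is beaten by [p ^ (m ^ 15)]. *)
Lemma masks_bound (R : realType) (p : R) : 0 <= p < 1 ->
  exists j0, forall j, (j0 <= j)%N ->
    (2 ^ j)%:R * ((((2 ^ j) ^ 24).+1 ^ ((2 ^ j) ^ 13))%:R * p ^+ ((2 ^ j) ^ 15)) <= 1.
Proof.
move=> /andP[p0 p1].
have [a pa] : exists a, p ^+ a <= 1 / 2.
  have half0 : 0 < 1 / 2 :> R by lra.
  have : `|p| < 1 by rewrite ger0_norm.
  move=> /(@cvg_expr R)/cvgrPdist_lt/(_ _ half0)[N _ /(_ N (leqnn N)) h].
  by exists N; move: h; rewrite /= sub0r normrN ger0_norm ?exprn_ge0// => /ltW.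
(* Chosen so that [26 * a <= m]: the exponent [e] below is at most [26 * m ^ 14], and each factor 2
   costs [a] factors [p]. *)
exists (26 * a)%N => j aj; set m := (2 ^ j)%N.
have jm : (j < m)%N by exact: ltn_expl.
have m0 : (0 < m)%N by rewrite expn_gt0.
have b1 : ((m ^ 24).+1 <= 2 ^ (25 * m))%N.
  apply: (@leq_trans (2 ^ (24 * j).+1)); last by rewrite leq_exp2l//; lia.
  have -> : (m ^ 24 = 2 ^ (24 * j))%N by rewrite /m -expnM mulnC.
  have : (0 < 2 ^ (24 * j))%N by rewrite expn_gt0.
  by rewrite expnS; lia.
set e := (25 * m * m ^ 13 + m)%N.
have b2 : (m * (m ^ 24).+1 ^ (m ^ 13) <= 2 ^ e)%N.
  rewrite /e expnD mulnC; apply: leq_mul; last by rewrite ltnW// ltn_expl.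
  by rewrite expnM; case: (m ^ 13)%N => // k; rewrite leq_exp2r.
have b3 : (a * e <= m ^ 15)%N.
  have -> : (m ^ 15 = m * (m * m ^ 13))%N by rewrite -!expnS.
  have : (m <= m * m ^ 13)%N by rewrite leq_pmulr// expn_gt0 m0.
  rewrite /e -mulnA; set z := (m * m ^ 13)%N => mz.
  apply: (@leq_trans (a * (26 * z))); first by rewrite leq_mul2l; apply/orP; right; lia.
  by rewrite mulnA [(a * 26)%N]mulnC leq_mul2r (leq_trans aj (ltnW jm)) orbT.
have pe : p ^+ (m ^ 15) <= (1 / 2) ^+ e.
  apply: (@le_trans _ _ (p ^+ (a * e))).
    by rewrite ler_wiXn2l// ltW.
  by rewrite exprM lerXn2r// ?nnegrE ?exprn_ge0//; lra.
rewrite mulrA -natrM; apply: (@le_trans _ _ ((2 ^ e)%:R * (1 / 2) ^+ e)).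
  by apply: ler_pM => //; [rewrite exprn_ge0|rewrite ler_nat].
by rewrite natrX -exprMn mulrC divrK ?expr1n// unitfE.
Qed.

Theorem proposition1p18 (R : realType) (d : measure_display)
    (T : measurableType d) (P : probability T R) (E : nat -> T -> int * int) :
  (forall (p : R) (D0 : T -> subgraph),
     0 <= p < 1 ->
     percolation P p D0 ->
     growing_walk P D0 E ->
     {ae P, forall w, transient (E^~ w)})
  /\
  (forall (D0 : subgraph) (r : R),
     verts D0 0 ->
     r < 3 / 4 ->
     (k%:R `^ (- r) * (sites_in_box D0 k)%:R : R) @[k --> \oo] --> (0 : R) ->
     growing_walk P (fun=> D0) E ->
     {ae P, forall w, transient (E^~ w)}).
Proof.
split=> [p D0 p01 perc walk|D0 r _ r34 sparse walk].
  have [j0 Hj0] := masks_bound p01.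
  have /andP[p0 p1] := p01.
  (* Union bound for [q = 6]: the number of patterns of at most [m ^ 13] stalls in [m ^ 24] steps,
     times the probability that [m ^ 15] given edges are open. *)
  pose eps j : R := (((2 ^ j) ^ 24).+1 ^ ((2 ^ j) ^ 13))%:R * p ^+ ((2 ^ j) ^ 15).
  have eps0 j : 0 <= eps j by rewrite mulr_ge0 ?exprn_ge0.
  apply: (@transient_ae _ _ _ _ _ _ walk 6 1 eps (j0 + 2)%N) => // j; last first.
    by move=> jj; apply: Hj0; lia.
  move=> u jj su us; set m := (2 ^ j)%N in su us *.
  have m3 : (3 < m)%N by apply: (@leq_trans (2 ^ 2)); rewrite ?leq_exp2l//; lia.
  pose v := take (m ^ (4 * 6)) u.
  pose B b := [set w | all (left_open (D0 w)) (open_sites v b)].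
  have mB b : measurable (B b).
    apply: (measurable_left_dep walk (l := open_sites v b) (Q := fun c => all c (open_sites v b))).
    by move=> c c' cc'; apply: eq_in_all.
  set A := ~` _; have mA : measurable A.
    by apply: measurableC; exact: measurable_avoid_set walk _ _ _.
  pose good b := (m ^ 15 <= size (open_sites v b))%N.
  apply: (@le_trans _ _ (\sum_(b <- [seq b <- masks (m ^ 24) (m ^ 13) | good b]) Pr P (B b))).
    apply: Pr_bigcup_le => // w /negP na.
    have [hb ho hs _] := unusual_open_sites m3 (isT : (3 < 6)%N) su us na.
    by exists (stalls (left_open (D0 w)) v); rewrite // mem_filter hb andbT.
  apply: (@le_trans _ _ (\sum_(b <- [seq b <- masks (m ^ 24) (m ^ 13) | good b]) p ^+ (m ^ 15))).
    rewrite big_seq [leRHS]big_seq; apply: ler_sum => b; rewrite mem_filter => /andP[gb _].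
    rewrite /Pr (percolation_left_open perc) ?open_sites_uniq//=.
    by rewrite ler_wiXn2l// ltW.
  rewrite big_const_seq iter_addr_0 count_predT -[_ *+ _]mulr_natl ler_wpM2r ?exprn_ge0//.
  rewrite ler_nat (leq_trans _ (size_masks _ _))//.
  by rewrite size_filter count_size.
have r0 : 0 < 3 - 4 * r by lra.
(* The inequality [rq] amounts to [3 <= q * (3 - 4 * r)]; adding 4 ensures [3 < q]. *)
pose q := (Num.bound (3 / (3 - 4 * r))).+4.
have rq : r * (4 * q)%:R <= (3 * q - 3)%:R.
  have : 3 / (3 - 4 * r) < (Num.bound (3 / (3 - 4 * r)))%:R.
    by apply: archi_boundP; rewrite divr_ge0// ltW.
  rewrite ltr_pdivrMr// natrB; last by rewrite /q; lia.
  have : (Num.bound (3 / (3 - 4 * r)))%:R <= q%:R :> R by rewrite ler_nat /q; lia.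
  rewrite !natrM; set x := (Num.bound _)%:R; set y := q%:R => xy h.
  have : x * (3 - 4 * r) <= y * (3 - 4 * r) by rewrite ler_wpM2r// ltW.
  lra.
have [N HN] := sites_in_box_eventually rq sparse.
(* The graph being fixed and sparse, no usual word fails at large scales, so the error is 0. The
   threshold gives both [N <= m ^ (4 * q)] and [4 <= m]. *)
apply: (@transient_ae _ _ _ _ _ _ walk q 0 (fun=> 0) (N + 2)%N) => [//|//|j u jj su us|j _];
  last by rewrite mulr0.
set m := (2 ^ j)%N in su us *.
have jm : (j < m)%N by exact: ltn_expl.
have m3 : (3 < m)%N by apply: (@leq_trans (2 ^ 2)); rewrite ?leq_exp2l//; lia.
have q3 : (3 < q)%N by [].
rewrite (_ : ~` _ = set0) ?Pr_set0//; apply/seteqP; split=> // w /negP na.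
have [hb ho hs hz] := unusual_open_sites m3 q3 su us na.
have := size_left_open_le (open_sites_uniq _ _) ho hz.
rewrite leqNgt => /negP; apply; apply: leq_trans hs; apply: HN; first by lia.
by rewrite (@leq_trans m)//; [lia | rewrite -{1}[m]expn1 leq_pexp2l//; lia].
Qed.
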